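(* Let $\mathcal{I}$ be an arbitrary index set, let $A=(A(i,j))_{i,j\in\mathcal{I}}$ be a matrix with entries in $\{0,1\}$ and having no zero rows, and let $(\mathsf{X}_A^+,\theta_{\mathsf{X}_A^+},\mathbb{F}_{\mathcal{I}})$ be the discrete partial dynamical system associated to the topological Markov chain $(\mathsf{X}_A^+,\sigma)$ of $A$. Then $C^*(\mathsf{X}_A^+,\theta_{\mathsf{X}_A^+},\mathbb{F}_{\mathcal{I}})$ is isomorphic to the unitization $\widetilde{\mathcal{O}}_A$ of $\mathcal{O}_A$. More precisely: if $(s_g)_{g\in\mathbb{F}_{\mathcal{I}}}$ denotes the generators of $C^*(\mathsf{X}_A^+,\theta_{\mathsf{X}_A^+},\mathbb{F}_{\mathcal{I}})$ and $(S_i)_{i\in\mathcal{I}}$ denotes the generators of $\mathcal{O}_A$, then $C^*(\mathsf{X}_A^+,\theta_{\mathsf{X}_A^+},\mathbb{F}_{\mathcal{I}})$ is generated by its unit and $\{s_i\mid i\in\mathcal{I}\}$, and there exists a unital $*$-isomorphism from $C^*(\mathsf{X}_A^+,\theta_{\mathsf{X}_A^+},\mathbb{F}_{\mathcal{I}})$ to $\widetilde{\mathcal{O}}_A$ which maps $s_i$ to $S_i$ for every $i\in\mathcal{I}$.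
   Context: The algebra $\mathcal{O}_A$ (Exel–Laca): the universal $C^*$-algebra generated by a family $(S_i)_{i\in\mathcal{I}}$ of partial isometries (its generators) such that: (1) for each pair of finite subsets $X,Y$ of $\mathcal{I}$ such that $A(X,Y,j):=\prod_{x\in X}A(x,j)\prod_{y\in Y}(1-A(y,j))$ is zero for all but finitely many $j\in\mathcal{I}$, one has $\prod_{x\in X}S_x^*S_x\prod_{y\in Y}(1-S_y^*S_y)=\sum_{j\in\mathcal{I}}A(X,Y,j)S_jS_j^*$; (2) $S_i^*S_i$ and $S_j^*S_j$ commute for all $i,j$; (3) $S_i^*S_j=0$ if $i\ne j$; (4) $S_i^*S_iS_j=A(i,j)S_j$ for all $i,j$. Here empty products equal $1$, and $1$ is the unit of the $C^*$-algebra generated by the $S_i$ if it is unital, and otherwise the unit of its unitization. The unitization $\widetilde{\mathcal{O}}_A$ is $\mathcal{O}_A$ itself if $\mathcal{O}_A$ is unital, and $\mathcal{O}_A$ with a unit adjoined otherwise. Topological Markov chain: $\mathsf{X}_A^+=\{(x_n)_{n\in\mathbb{N}_0}\in\mathcal{I}^{\mathbb{N}_0}\mid \forall k\in\mathbb{N}_0: A(x_k,x_{k+1})=1\}$, and $\sigma:\mathsf{X}_A^+\to\mathsf{X}_A^+$, $x_0x_1x_2\cdots\mapsto x_1x_2\cdots$. Discrete partial dynamical systems: a partial action $\theta$ of a group $G$ (neutral element $e$) on a set $X$ is a pair $((D_g)_{g\in G},(\theta_g)_{g\in G})$ with $D_g\subseteq X$ (the domains) and $\theta_g:D_{g^{-1}}\to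 D_g$ bijections (the partial one-to-one maps) such that for all $h,i\in G$: $D_e=X$ and $\theta_e=\mathrm{Id}_X$; $\theta_h(D_i)=D_h\cap D_{hi}$; $\theta_h(\theta_i(x))=\theta_{hi}(x)$ for $x\in D_{i^{-1}}\cap D_{i^{-1}h^{-1}}$. Here $\theta_g(A)$ means $\theta_g(A\cap D_{g^{-1}})$ for $A\subseteq X$. The triple $(X,\theta,G)$ is a discrete partial dynamical system. The system associated to $(\mathsf{X}_A^+,\sigma)$: $\mathbb{F}_{\mathcal{I}}$ is the free group generated by $\mathcal{I}$. For $a\in\mathcal{I}$ let $D_a=\{x\in\mathsf{X}_A^+\mid x_0=a\}$, $D_{a^{-1}}=\sigma(D_a)$, $\theta_a:D_{a^{-1}}\to D_a$, $x\mapsto ax$, and $\theta_{a^{-1}}:D_a\to D_{a^{-1}}$, $x\mapsto\sigma(x)$. For $g\in\mathbb{F}_{\mathcal{I}}$ with reduced form $b_1b_2\cdots b_k$ ($b_j\in\mathcal{I}\cup\mathcal{I}^{-1}$), $\theta_g=\theta_{b_1}\circ\cdots\circ\theta_{b_k}$ (composition of partial maps) and $D_g=\theta_{b_1}\circ\cdots\circ\theta_{b_k}(\mathsf{X}_A^+)$; $D_e=\mathsf{X}_A^+$, $\theta_e=\mathrm{Id}$. Then $\theta_{\mathsf{X}_A^+}=((D_g),(\theta_g))$ is a partial action of $\mathbb{F}_{\mathcal{I}}$ on $\mathsf{X}_A^+$. The $C^*$-algebra: $\mathcal{B}(X,\theta,G)$ is the Boolean algebra of subsets of $X$ generated by $\{D_g\mid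 g\in G\}$. $C^*(X,\theta,G)$ is the universal $C^*$-algebra generated by a family $(s_g)_{g\in G}$ (its generators) such that: (i) the $s_g$ are partial isometries with commuting range projections; (ii) $s_e=1$; (iii) $s_{g^{-1}}=s_g^*$ for all $g$; (iv) $s_hs_i=s_hs_h^*s_{hi}$ for all $h,i$; (v) the map $D_g\mapsto s_gs_g^*$ extends to a Boolean homomorphism from $\mathcal{B}(X,\theta,G)$ to the Boolean algebra of projections (with $p\wedge q=pq$, $p\vee q=p+q-pq$, $\neg p=1-p$) of the unital abelian $C^*$-algebra $C^*(\{s_gs_g^*\mid g\in G\})$. A Boolean homomorphism is a map preserving $\wedge,\vee,\neg$. *)

(* Defs.v *)
From HB Require Import structures.
From mathcomp Require Import all_boot all_order all_algebra finmap.
From mathcomp Require Import complex.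
From mathcomp Require Import all_classical all_reals all_analysis.

Set Implicit Arguments.
Unset Strict Implicit.
Unset Printing Implicit Defensive.

Import Order.TTheory GRing.Theory Num.Theory numFieldNormedType.Exports.

Local Open Scope classical_set_scope.
Local Open Scope ring_scope.

Section FreeGroup.
Variable I : choiceType.

(* [(a, false)] stands for the letter a and [(a, true)] for a^-1. *)
Definition letter : Type := (I * bool)%type.
HB.instance Definition _ := Choice.on letter.

Definition linv (l : letter) : letter := (l.1, ~~ l.2).

Definition reduced (w : seq letter) : bool :=
  sorted (fun l m => m != linv l) w.

Record freegrp := FreeGrp { fword : seq letter; fwordP : reduced fword }.

HB.instance Definition _ := [isSub for fword].
HB.instance Definition _ := [Choice of freegrp by <:].

(* Left multiplication of a reduced word by a letter. *)
Definition fcons (l : letter) (w : seq letter) : seq letter :=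
  if w is m :: w' then if m == linv l then w' else l :: w else [:: l].

Definition wmul (u v : seq letter) : seq letter := foldr fcons v u.
Definition winv (w : seq letter) : seq letter := rev (map linv w).

Lemma linvK : involutive linv.
Proof. by case=> a b; rewrite /linv /= negbK. Qed.

Lemma reduced_tl l w : reduced (l :: w) -> reduced w.
Proof. by rewrite /reduced /=; case: w => //= m w /andP[]. Qed.

Lemma reduced_fcons l w : reduced w -> reduced (fcons l w).
Proof.
case: w => //= m w rw; case: ifPn => [_|ml]; first exact: reduced_tl rw.
by rewrite /reduced /= ml.
Qed.

Lemma reduced_wmul u v : reduced v -> reduced (wmul u v).
Proof. by move=> rv; elim: u => //= l u; exact: reduced_fcons. Qed.

Lemma fconsE l w : reduced (l :: w) -> fcons l w = l :: w.
Proof. by rewrite /reduced; case: w => //= m w /andP[/negPf ->]. Qed.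

Lemma wmul_nil w : reduced w -> wmul w [::] = w.
Proof.
elim: w => //= l w ih rw; rewrite -/(wmul w [::]) ih; last exact: reduced_tl rw.
exact: fconsE.
Qed.

Lemma fconsK l w : reduced w -> fcons l (fcons (linv l) w) = w.
Proof.
case: w => [|m w] rw /=; first by rewrite eqxx.
move: rw; rewrite linvK; case: eqVneq => [-> rw|_ _]; first exact: fconsE.
by rewrite /= eqxx.
Qed.

Lemma wmul_fcons l v w : reduced w -> wmul (fcons l v) w = fcons l (wmul v w).
Proof.
move=> rw; case: v => //= m v; case: eqVneq => [->|_] //=.
by rewrite fconsK // reduced_wmul.
Qed.

Lemma wmulA u v w : reduced w -> wmul u (wmul v w) = wmul (wmul u v) w.
Proof. by move=> rw; elim: u => //= l u ->; rewrite wmul_fcons. Qed.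

Lemma wmul_cat u v w : wmul (u ++ v) w = wmul u (wmul v w).
Proof. exact: foldr_cat. Qed.

Lemma winv_cons l w : winv (l :: w) = winv w ++ [:: linv l].
Proof. by rewrite /winv /= rev_cons cats1. Qed.

Lemma winvK : involutive winv.
Proof.
by move=> w; rewrite /winv map_rev revK (mapK linvK).
Qed.

Lemma wmulVw w v : reduced v -> wmul (winv w) (wmul w v) = v.
Proof.
move=> rv; elim: w => //= l w ih.
rewrite winv_cons wmul_cat /= -[in fcons l](linvK l) fconsK ?reduced_wmul //.
Qed.

Lemma reduced_winv w : reduced w -> reduced (winv w).
Proof.
rewrite /reduced /winv rev_sorted => rw; rewrite sorted_map.
by apply: sub_sorted rw => l m /=; rewrite linvK; apply: contra => /eqP ->.
Qed.

Definition fone := @FreeGrp [::] isT.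
Definition fmul (g h : freegrp) :=
  FreeGrp (reduced_wmul (fword g) (fwordP h)).
Definition finv (g : freegrp) := FreeGrp (reduced_winv (fwordP g)).

Lemma fmulA : associative fmul.
Proof. by move=> f g h; apply: val_inj; apply: wmulA; exact: fwordP. Qed.
Lemma fmul1g : left_id fone fmul.
Proof. by move=> g; apply: val_inj. Qed.
Lemma fmulg1 : right_id fone fmul.
Proof. by move=> g; apply: val_inj; apply: wmul_nil; exact: fwordP. Qed.
Lemma fmulVg : left_inverse fone finv fmul.
Proof.
move=> g; apply: val_inj => /=.
by rewrite -[X in wmul _ X]wmul_nil ?wmulVw //; exact: fwordP.
Qed.
Lemma fmulgV : right_inverse fone finv fmul.
Proof.
move=> g; rewrite -[X in fmul X _](_ : finv (finv g) = g) ?fmulVg //.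
by apply: val_inj; exact: winvK.
Qed.

HB.instance Definition _ :=
  isGroup.Build freegrp fmulA fmul1g fmulg1 fmulVg fmulgV.

Definition fgen (a : I) : freegrp := @FreeGrp [:: (a, false)] isT.

End FreeGroup.

(* The space is a subset [X] of a type [T], and [pact g : T -> T] is only
   meaningful on [pdom g^-1]. *)
Record partialAction (G : groupType) (T : Type) (X : set T) := PartialAction {
  pdom : G -> set T;
  pact : G -> T -> T;
  pdom_sub : forall g, pdom g `<=` X;
  pact_bij : forall g, set_bij (pdom g^-1%g) (pdom g) (pact g);
  pdom1 : pdom 1%g = X;
  pact1 : forall x, X x -> pact 1%g x = x;
  pact_dom : forall h i,
    pact h @` (pdom i `&` pdom h^-1%g) = pdom h `&` pdom (h * i)%g;
  pactM : forall h i x, (pdom i^-1%g `&` pdom (i^-1 * h^-1)%g) x ->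
    pact h (pact i x) = pact (h * i)%g x
}.

Section MarkovChain.
Variables (I : choiceType) (A : I -> I -> bool).

Definition markov_chain : set (nat -> I) :=
  [set x | forall k, A (x k) (x k.+1)].

Definition shift_seq (x : nat -> I) : nat -> I := fun n => x n.+1.
Definition cons_seq (a : I) (x : nat -> I) : nat -> I :=
  fun n => if n is m.+1 then x m else a.

Definition letter_act (l : letter I) : (nat -> I) -> (nat -> I) :=
  if l.2 then shift_seq else cons_seq l.1.

Definition letter_dom (l : letter I) : set (nat -> I) :=
  let D := [set x | markov_chain x /\ x 0%N = l.1] in
  if l.2 then shift_seq @` D else D.

Fixpoint word_act (w : seq (letter I)) (x : nat -> I) : nat -> I :=
  if w is l :: w' then letter_act l (word_act w' x) else x.

Fixpoint word_dom (w : seq (letter I)) : set (nat -> I) :=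
  if w is l :: w' then
    letter_act l @` (word_dom w' `&` letter_dom (linv l))
  else markov_chain.

(* The domain of the composition of the partial maps given by the letters of
   [w]; [word_dom w] is its range. *)
Fixpoint word_src (w : seq (letter I)) (x : nat -> I) : Prop :=
  if w is l :: w' then word_src w' x /\ letter_dom (linv l) (word_act w' x)
  else markov_chain x.

Lemma letter_dom_sub l : letter_dom l `<=` markov_chain.
Proof.
rewrite /letter_dom => x; case: ifP => _ /=; last by case.
by move=> [y [yX _] <-] k; exact: yX.
Qed.

Lemma letter_actK l x : letter_dom (linv l) x ->
  letter_dom l (letter_act l x) /\ letter_act (linv l) (letter_act l x) = x.
Proof.
case: l => a []; rewrite /letter_dom /letter_act /=.
  move=> [xX x0]; split; first by exists x.
  by apply/funext => -[|n] //=; rewrite x0.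
move=> [y [yX y0] <-]; split; last by apply/funext.
split=> // -[|k] /=; last exact: yX.
by rewrite -y0; exact: yX.
Qed.

Lemma word_src_sub w x : word_src w x -> markov_chain x.
Proof. by elim: w => //= l w ih [/ih]. Qed.

Lemma word_act_cat u v x : word_act (u ++ v) x = word_act u (word_act v x).
Proof. by elim: u => //= l u ->. Qed.

Lemma word_act_sub w x : word_src w x -> markov_chain (word_act w x).
Proof.
elim: w => //= l w ih [_ /letter_actK[+ _]]; exact: letter_dom_sub.
Qed.

Lemma word_src_cat u v x :
  word_src (u ++ v) x <-> word_src v x /\ word_src u (word_act v x).
Proof.
elim: u => [|l u ih] /=.
  by split=> [xv|[]//]; split=> //; exact: word_act_sub.
by rewrite word_act_cat; split=> [[/ih[] ? ? ?]|[? [? ?]]]; split=> //; apply/ih.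
Qed.

Lemma word_actK w x : word_src w x ->
  word_src (winv w) (word_act w x) /\ word_act (winv w) (word_act w x) = x.
Proof.
elim: w => //= l w ih [/ih[sw aw] /letter_actK[dl al]].
rewrite winv_cons word_act_cat /= al; split=> //.
apply/word_src_cat; rewrite /= linvK al; split=> //; split=> //.
exact: letter_dom_sub dl.
Qed.

Lemma word_domE w : word_dom w = word_src (winv w).
Proof.
have domE v : word_dom v = word_act v @` word_src v.
  elim: v => [|l v ih] /=; first by rewrite image_id.
  rewrite ih; apply/seteqP; split=> y /=.
    by move=> [_ [[x xv <-] xl] <-]; exists x.
  by move=> [x [xv xl] <-]; exists (word_act v x) => //; split=> //; exists x.
rewrite domE; apply/seteqP; split=> y /=; first by move=> [x /word_actK[? _] <-].
by move=> /word_actK[]; rewrite winvK => *; exists (word_act (winv w) y).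
Qed.

Lemma word_fcons l w x : word_src (l :: w) x ->
  word_src (fcons l w) x /\ word_act (fcons l w) x = word_act (l :: w) x.
Proof.
case: w => [|m w] //=; case: eqVneq => [->|_] //=.
rewrite linvK => -[[sw dl] _]; split=> //.
have := @letter_actK (linv l) (word_act w x).
by rewrite linvK => /(_ dl)[_ ->].
Qed.

Lemma word_wmul u v x : word_src (u ++ v) x ->
  word_src (wmul u v) x /\ word_act (wmul u v) x = word_act (u ++ v) x.
Proof.
elim: u => //= l u ih [/ih[sw aw] dl].
rewrite -aw in dl *; exact: word_fcons (conj sw dl).
Qed.

Lemma word_src_wmul u v x : reduced u -> reduced v ->
  word_src v x -> word_src (wmul u v) x -> word_src u (word_act v x).
Proof.
move=> ru rv xv xuv; have [vx av] := word_actK xv.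
have : word_src (wmul u v ++ winv v) (word_act v x).
  by apply/word_src_cat; rewrite av.
move=> /word_wmul[+ _]; rewrite -wmulA ?reduced_winv //.
suff -> : wmul v (winv v) = [::] by rewrite wmul_nil.
rewrite -[X in wmul _ X]wmul_nil ?reduced_winv // -[X in wmul X _]winvK.
exact: wmulVw.
Qed.

Definition markov_dom (g : freegrp I) : set (nat -> I) := word_dom (fword g).
Definition markov_act (g : freegrp I) := word_act (fword g).

Let src (g : freegrp I) x := word_src (fword g) x.

Let domE g : markov_dom g = src g^-1%g.
Proof. exact: word_domE. Qed.

Let domVE g : markov_dom g^-1%g = src g.
Proof. by rewrite domE invgK. Qed.

Let actK g x : src g x ->
  src g^-1%g (markov_act g x) /\ markov_act g^-1%g (markov_act g x) = x.
Proof. exact: word_actK. Qed.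

Let actM g h x : src h x -> src g (markov_act h x) ->
  src (g * h)%g x /\ markov_act (g * h)%g x = markov_act g (markov_act h x).
Proof.
move=> hx ghx; rewrite /markov_act -word_act_cat.
by apply: word_wmul; apply/word_src_cat.
Qed.

Let srcM g h x : src h x -> src (g * h)%g x -> src g (markov_act h x).
Proof. exact: word_src_wmul (fwordP g) (fwordP h). Qed.

Lemma markov_dom_sub g : markov_dom g `<=` markov_chain.
Proof. by rewrite domE => x; exact: word_src_sub. Qed.

Lemma markov_act_bij g :
  set_bij (markov_dom g^-1%g) (markov_dom g) (markov_act g).
Proof.
rewrite domVE domE; split=> [x /actK[]//|x y|y yg].
  by move=> /set_mem/actK[_ {2}<-] /set_mem/actK[_ {2}<-] ->.
by have [] := actK yg; rewrite invgK => *; exists (markov_act g^-1%g y).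
Qed.

Lemma markov_dom1 : markov_dom 1%g = markov_chain.
Proof. by []. Qed.

Lemma markov_act1 x : markov_chain x -> markov_act 1%g x = x.
Proof. by []. Qed.

Lemma markov_act_dom h i :
  markov_act h @` (markov_dom i `&` markov_dom h^-1%g) =
  markov_dom h `&` markov_dom (h * i)%g.
Proof.
rewrite !domE invgK invgM; apply/seteqP; split=> y /=.
  move=> [x [xi xh] <-]; have [yh ay] := actK xh; split=> //.
  by have [] := @actM i^-1%g h^-1%g (markov_act h x) yh; rewrite ?ay.
move=> [yh yhi]; have [xh ax] := actK yh; exists (markov_act h^-1%g y).
  by split; [exact: srcM|rewrite invgK in xh].
by rewrite invgK in ax.
Qed.

Lemma markov_actM h i x :
  (markov_dom i^-1%g `&` markov_dom (i^-1 * h^-1)%g) x ->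
  markov_act h (markov_act i x) = markov_act (h * i)%g x.
Proof.
rewrite -invgM !domVE => -[xi xhi]; have xh := srcM xi xhi.
by have [_ ->] := actM xi xh.
Qed.

Definition markov_system : partialAction (freegrp I) markov_chain :=
  PartialAction markov_dom_sub markov_act_bij markov_dom1 markov_act1
    markov_act_dom markov_actM.

End MarkovChain.

Reserved Notation "a ** b" (at level 40, left associativity).

(* C*-algebras are not assumed to be unital, and may be zero. *)
HB.mixin Record isCstarAlgebra (R : realType) B
    & CompleteNormedModule R[i]%C B := {
  cmul : B -> B -> B;
  star : B -> B;
  cmulA : associative cmul;
  cmulDl : left_distributive cmul +%R;
  cmulDr : right_distributive cmul +%R;
  cmulZl : forall (k : R[i]%C) a b, cmul (k *: a) b = k *: cmul a b;
  cmulZr : forall (k : R[i]%C) a b, cmul a (k *: b) = k *: cmul a b;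
  starK : involutive star;
  starD : {morph star : a b / a + b};
  starZ : forall (k : R[i]%C) a, star (k *: a) = (k^*)%R *: star a;
  starM : forall a b, star (cmul a b) = cmul (star b) (star a);
  cnormM : forall a b, `|cmul a b| <= `|a| * `|b|;
  cstar_identity : forall a, `|cmul (star a) a| = `|a| ^+ 2
}.

#[short(type="cstarType")]
HB.structure Definition CstarAlgebra (R : realType) :=
  { B of isCstarAlgebra R B & CompleteNormedModule R[i]%C B }.

Notation "a ** b" := (cmul a b) : ring_scope.

Section CstarTheory.
Variables (R : realType) (B : cstarType R).
Implicit Types a b : B.

Lemma cmul0l a : 0 ** a = 0.
Proof. by rewrite -(scale0r (0 : B)) cmulZl !scale0r. Qed.

Lemma cmul0r a : a ** 0 = 0.
Proof. by rewrite -(scale0r (0 : B)) cmulZr !scale0r. Qed.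

Lemma star0 : star (0 : B) = 0.
Proof. by rewrite -(scale0r (0 : B)) starZ conjC0 !scale0r. Qed.

Lemma cnorm_star a : `|star a| = `|a|.
Proof.
suff le b : `|b| <= `|star b| by apply/eqP; rewrite eq_le le -{2}(starK a) le.
have [->|b0] := eqVneq b 0; first by rewrite normr0.
by rewrite -(ler_pM2r (x := `|b|)) ?normr_gt0 // -expr2 -cstar_identity cnormM.
Qed.

Definition is_unit (e : B) : Prop := forall a, e ** a = a /\ a ** e = a.

Definition is_unital : Prop := exists e, is_unit e.

Definition is_cstar_subalgebra (V : set B) : Prop :=
  [/\ V 0,
      forall a b, V a -> V b -> V (a + b),
      forall (k : R[i]%C) a, V a -> V (k *: a),
      forall a b, V a -> V b -> V (a ** b) &
      forall a, V a -> V (star a)] /\ closed V.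

(* The C*-algebra generated by [S], inside [B]. *)
Definition cstar_gen (S : set B) : set B := smallest is_cstar_subalgebra S.

Definition is_projection (p : B) : Prop := p ** p = p /\ star p = p.

Definition is_partial_isometry (s : B) : Prop := s ** star s ** s = s.

End CstarTheory.

Definition is_star_hom (R : realType) (B B' : cstarType R) (f : B -> B') :=
  [/\ forall a b, f (a + b) = f a + f b,
      forall (k : R[i]%C) a, f (k *: a) = k *: f a,
      forall a b, f (a ** b) = f a ** f b &
      forall a, f (star a) = star (f a)].

Definition is_star_iso (R : realType) (B B' : cstarType R) (f : B -> B') :=
  is_star_hom f /\ bijective f.

Definition is_unital_map (R : realType) (B B' : cstarType R) (f : B -> B') :=
  forall e : B, is_unit e -> is_unit (f e).

(* The direct sum of B and C, as a *-algebra with unit (0, 1). Its norm is the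
   maximum of the modulus of the scalar part and of the norm as an operator on
   B by left multiplication; if B is not unital the former is redundant. *)

Section AdjoinUnit.
Variables (R : realType) (B : cstarType R).

Local Notation C := (R[i]%C).

Definition adjoin_unit : Type := (B * C^o)%type.
HB.instance Definition _ := GRing.Lmodule.copy adjoin_unit (B * C^o)%type.

Implicit Types x y z : adjoin_unit.

Definition adj_lmul x (b : B) : B := x.1 ** b + x.2 *: b.

Definition adj_rnorms x : set R :=
  [set complex.Re `|adj_lmul x b| | b in [set b : B | `|b| <= 1]].

Definition adj_rnorm x : R :=
  Num.max (complex.Re (`|x.2| : C)) (sup (adj_rnorms x)).

Definition adj_norm x : C := (adj_rnorm x)%:C%C.

Definition adj_mul x y : adjoin_unit :=
  (x.1 ** y.1 + x.2 *: y.1 + y.2 *: x.1, x.2 * y.2).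

Definition adj_star x : adjoin_unit := (star x.1, (x.2^*)%R).

Definition adj_one : adjoin_unit := (0, 1).

Definition adj_in (b : B) : adjoin_unit := (b, 0).

Lemma ReK (k : C) : 0 <= k -> (complex.Re k)%:C%C = k.
Proof. by move=> k0; apply: RRe_real; exact: ger0_real. Qed.

Lemma adj_lmul_le x b : `|adj_lmul x b| <= (`|x.1| + `|x.2|) * `|b|.
Proof.
rewrite (le_trans (ler_normD _ _)) // mulrDl normrZ lerD2r.
exact: cnormM.
Qed.

Lemma adj_rnorms_bounded x : has_ubound (adj_rnorms x).
Proof.
exists (complex.Re (`|x.1| + `|x.2|)) => _ [b /= b1 <-].
rewrite -lecR !ReK ?addr_ge0 //; apply: le_trans (adj_lmul_le x b) _.
by rewrite ler_piMr // addr_ge0.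
Qed.

Lemma adj_rnorms_has_sup x : has_sup (adj_rnorms x).
Proof.
split; last exact: adj_rnorms_bounded.
by exists (complex.Re `|adj_lmul x 0|), 0; rewrite //= normr0.
Qed.

Lemma adj_norm_le x (k : C) : 0 <= k ->
  adj_norm x <= k <->
  `|x.2| <= k /\ forall b, `|adj_lmul x b| <= k * `|b|.
Proof.
move=> k0; rewrite -{1}(ReK k0) lecR ge_max; split.
  move=> /andP[k1 k2]; split.
    by rewrite -(ReK (normr_ge0 _)) -(ReK k0) lecR.
  move=> b; have [->|b0] := eqVneq b 0.
    by rewrite /adj_lmul cmul0r scaler0 addr0 normr0 mulr0.
  have nb0 : 0 < `|b| by rewrite normr_gt0.
  have /(ub_le_sup (adj_rnorms_bounded x)) :
      adj_rnorms x (complex.Re `|adj_lmul x (`|b|^-1 *: b)|).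
    by exists (`|b|^-1 *: b) => //=; rewrite normfZV.
  move=> /le_trans/(_ k2); rewrite -lecR !ReK //.
  rewrite /adj_lmul cmulZr scalerA mulrC -scalerA -scalerDr normrZ.
  by rewrite normfV normr_id mulrC ler_pdivrMr.
move=> [k1 k2]; apply/andP; split; first by rewrite -lecR !ReK.
apply: ge_sup; first by case: (adj_rnorms_has_sup x).
move=> _ [b /= b1 <-]; rewrite -lecR !ReK //.
by rewrite (le_trans (k2 b)) // ler_piMr.
Qed.

Lemma adj_norm_ge0 x : 0 <= adj_norm x.
Proof.
by rewrite ler0c le_max; apply/orP; left; rewrite -ler0c ReK.
Qed.

Lemma adj_norm_scal x : `|x.2| <= adj_norm x.
Proof. by have /adj_norm_le[] := lexx (adj_norm x); rewrite ?adj_norm_ge0. Qed.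

Lemma adj_norm_lmul x b : `|adj_lmul x b| <= adj_norm x * `|b|.
Proof. by have /adj_norm_le[] := lexx (adj_norm x); rewrite ?adj_norm_ge0. Qed.

Lemma adj_norm_sum x : adj_norm x <= `|x.1| + `|x.2|.
Proof.
apply/adj_norm_le; rewrite ?addr_ge0 //; split; first by rewrite lerDr.
exact: adj_lmul_le.
Qed.

Lemma adj_norm_vec x : `|x.1| <= adj_norm x *+ 2.
Proof.
have [->|x0] := eqVneq x.1 0; first by rewrite normr0 mulrn_wge0 ?adj_norm_ge0.
rewrite -(ler_pM2r (x := `|x.1|)) ?normr_gt0 //.
have -> : `|x.1| * `|x.1| = `|x.1 ** star x.1|.
  by rewrite -expr2 -(cnorm_star x.1) -cstar_identity starK.
rewrite -(addrK (x.2 *: star x.1) (x.1 ** star x.1)) mulrnAl mulr2n.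
apply: le_trans (ler_normB _ _) _; rewrite lerD //.
  by rewrite -(cnorm_star x.1); exact: adj_norm_lmul.
by rewrite normrZ cnorm_star ler_wpM2r ?adj_norm_scal.
Qed.

Lemma adj_ler_normD x y : adj_norm (x + y) <= adj_norm x + adj_norm y.
Proof.
apply/adj_norm_le; rewrite ?addr_ge0 ?adj_norm_ge0 //; split=> [|b].
  by rewrite (le_trans (ler_normD _ _)) // lerD ?adj_norm_scal.
have -> : adj_lmul (x + y) b = adj_lmul x b + adj_lmul y b.
  by rewrite /adj_lmul cmulDl scalerDl addrACA.
by rewrite (le_trans (ler_normD _ _)) // mulrDl lerD ?adj_norm_lmul.
Qed.

Lemma adj_normrZ_le (k : C) x : adj_norm (k *: x) <= `|k| * adj_norm x.
Proof.
apply/adj_norm_le; rewrite ?mulr_ge0 ?adj_norm_ge0 //; split=> [|b].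
  by rewrite normrM ler_wpM2l ?adj_norm_scal.
have -> : adj_lmul (k *: x) b = k *: adj_lmul x b.
  by rewrite /adj_lmul cmulZl scalerDr scalerA.
by rewrite normrZ -mulrA ler_wpM2l ?adj_norm_lmul.
Qed.

Lemma adj_normrZ (k : C) x : adj_norm (k *: x) = `|k| * adj_norm x.
Proof.
apply/eqP; rewrite eq_le adj_normrZ_le /=.
have [->|k0] := eqVneq k 0; first by rewrite normr0 mul0r adj_norm_ge0.
rewrite -ler_pdivlMl ?normr_gt0 // -normfV -{1}(scalerK k0 x).
exact: adj_normrZ_le.
Qed.

Lemma adj_norm_eq0 x : adj_norm x = 0 -> x = 0.
Proof.
move=> x0; have := adj_norm_vec x; have := adj_norm_scal x.
by rewrite x0 mul0rn !normr_le0; case: x {x0} => a k /= /eqP -> /eqP ->.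
Qed.

HB.instance Definition _ := Lmodule_isNormed.Build C adjoin_unit
  adj_ler_normD adj_normrZ adj_norm_eq0.

Lemma adj_normE x : `|x| = adj_norm x. Proof. by []. Qed.

Lemma normc_ge_Im (z : C) : `|complex.Im z|%:C%C <= `|z|.
Proof. by rewrite normc_def lecR -sqrtr_sqr ler_wsqrtr // lerDr sqr_ge0. Qed.

Lemma normc_le (z : C) :
  `|z| <= (`|complex.Re z| + `|complex.Im z|)%:C%C.
Proof.
rewrite normc_def lecR -[leRHS]ger0_norm ?addr_ge0 // -sqrtr_sqr ler_wsqrtr //.
by rewrite sqrrD !real_normK ?num_real // lerD2r lerDl mulrn_wge0 // mulr_ge0.
Qed.

Lemma complex_complete (F : set_system C^o) :
  ProperFilter F -> cauchy F -> cvg F.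
Proof.
move=> FF /cauchyP Fc.
have comp (f : C^o -> R) : (forall z w : C^o, `|f z - f w|%:C%C <= `|z - w|) ->
    exists l : R, f @ F --> l.
  move=> fle; apply/cvg_ex; apply: cauchy_cvg.
  apply/cauchyP => e e0; have [|z Fz] := Fc e%:C%C; first by rewrite ltcR.
  exists (f z); change (F (f @^-1` ball (f z) e)).
  apply: filterS Fz => w zw; rewrite /preimage -ball_normE /= -ltcR.
  exact: le_lt_trans (fle _ _) zw.
have [|a Fa] := comp (@complex.Re R).
  by move=> [a1 a2] [b1 b2]; exact: (normc_ge_Re ((a1 +i* a2)%C - (b1 +i* b2)%C)).
have [|b Fb] := comp (@complex.Im R).
  by move=> [a1 a2] [b1 b2]; exact: (normc_ge_Im ((a1 +i* a2)%C - (b1 +i* b2)%C)).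
apply/cvg_ex; exists (a +i* b)%C; apply/cvgrPdist_lt => /= e e0.
have eE := ReK (ltW e0); have d0 : 0 < complex.Re e / 2.
  by rewrite divr_gt0 // -ltcR eE.
move/cvgrPdist_lt : Fa => /(_ _ d0) Fa; move/cvgrPdist_lt : Fb => /(_ _ d0) Fb.
apply: filterS2 Fa Fb => -[c d] /= ca db.
apply: le_lt_trans (normc_le _) _.
by rewrite -eE ltcR [complex.Re e]splitr ltrD.
Qed.

Lemma adj_complete (F : set_system adjoin_unit) :
  ProperFilter F -> cauchy F -> cvg F.
Proof.
move=> FF /cauchyP Fc.
have comp (V : normedModType C) (f : adjoin_unit -> V) :
    (forall x y, `|f x - f y| <= `|x - y| *+ 2) -> cauchy (f @ F).
  move=> fle; apply/cauchyP => e e0.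
  have [|x Fx] := Fc (e / 2); first by rewrite divr_gt0.
  exists (f x); change (F (f @^-1` ball (f x) e)); apply: filterS Fx => y.
  rewrite /preimage /= -!ball_normE /= => xy; apply: le_lt_trans (fle _ _) _.
  by rewrite -mulr_natr -ltr_pdivlMr.
have /cauchy_cvg/cvg_ex[a Fa] : cauchy ((fun x : adjoin_unit => x.1) @ F).
  by apply: comp => x y; exact: adj_norm_vec (x - y).
have /complex_complete/cvg_ex[k Fk] :
    cauchy ((fun x : adjoin_unit => x.2 : C^o) @ F).
  apply: comp => x y; apply: le_trans (adj_norm_scal (x - y)) _.
  by rewrite mulr2n lerDl adj_norm_ge0.
apply/cvg_ex; exists ((a, k) : adjoin_unit); apply/cvgrPdist_lt => /= e e0.
have d0 : 0 < e / 2 by rewrite divr_gt0.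
move/cvgrPdist_lt : Fa => /(_ _ d0) Fa; move/cvgrPdist_lt : Fk => /(_ _ d0) Fk.
apply: filterS2 Fa Fk => x xa xk; rewrite [e]splitr.
apply: le_lt_trans (adj_norm_sum _) _; exact: ltrD.
Qed.

HB.instance Definition _ := Uniform_isComplete.Build adjoin_unit adj_complete.

Lemma adj_lmulM x y b : adj_lmul (adj_mul x y) b = adj_lmul x (adj_lmul y b).
Proof.
rewrite /adj_lmul /= !(cmulDl, cmulDr, cmulZl, cmulZr, scalerDr, scalerA, cmulA).
by rewrite -!addrA; congr (_ + _); rewrite addrCA.
Qed.

Lemma adj_mulA : associative adj_mul.
Proof.
move=> [a k] [b l] [c m]; rewrite /adj_mul /= mulrA; congr pair.
rewrite !(cmulDl, cmulDr, cmulZl, cmulZr, scalerDr, scalerA, cmulA) !addrA.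
by rewrite [LHS](ACl (1*4*2*5*3*6*7))%AC /= [m * k]mulrC [m * l]mulrC.
Qed.

Lemma adj_mulDl : left_distributive adj_mul +%R.
Proof.
move=> x y z; rewrite /adj_mul /=; congr pair; last by rewrite mulrDl.
by rewrite cmulDl scalerDl scalerDr (addrACA (x.1 ** z.1)) [LHS]addrACA.
Qed.

Lemma adj_mulDr : right_distributive adj_mul +%R.
Proof.
move=> x y z; rewrite /adj_mul /=; congr pair; last by rewrite mulrDr.
by rewrite cmulDr scalerDl scalerDr (addrACA (x.1 ** y.1)) [LHS]addrACA.
Qed.

Lemma adj_mulZl (k : C) x y : adj_mul (k *: x) y = k *: adj_mul x y.
Proof.
rewrite /adj_mul /=; congr pair; last exact: esym (mulrA _ _ _).
by rewrite cmulZl !scalerDr !scalerA [y.2 * k]mulrC.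
Qed.

Lemma adj_mulZr (k : C) x y : adj_mul x (k *: y) = k *: adj_mul x y.
Proof.
rewrite /adj_mul /=; congr pair; last exact: mulrCA.
by rewrite cmulZr !scalerDr !scalerA [x.2 * k]mulrC.
Qed.

Lemma adj_starK : involutive adj_star.
Proof. by move=> [a k]; rewrite /adj_star /= starK conjCK. Qed.

Lemma adj_starD : {morph adj_star : x y / x + y}.
Proof. by move=> x y; rewrite /adj_star /= starD rmorphD. Qed.

Lemma adj_starZ (k : C) x : adj_star (k *: x) = (k^*)%R *: adj_star x.
Proof. by rewrite /adj_star /= starZ rmorphM. Qed.

Lemma adj_starM x y : adj_star (adj_mul x y) = adj_mul (adj_star y) (adj_star x).
Proof.
rewrite /adj_star /adj_mul /= rmorphM mulrC; congr pair.
by rewrite !starD !starZ starM addrAC.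
Qed.

Lemma adj_normM x y : `|adj_mul x y| <= `|x| * `|y|.
Proof.
apply/adj_norm_le; first by rewrite mulr_ge0 ?adj_norm_ge0.
split=> [|b]; first by rewrite normrM ler_pM ?adj_norm_scal.
rewrite adj_lmulM (le_trans (adj_norm_lmul _ _)) // -mulrA.
by rewrite ler_wpM2l ?adj_norm_ge0 ?adj_norm_lmul.
Qed.

Lemma adj_lmul_star x b c :
  star (adj_lmul x b) ** c = star b ** adj_lmul (adj_star x) c.
Proof.
rewrite /adj_lmul /= starD starM starZ cmulDl cmulDr cmulZl cmulZr.
by rewrite cmulA.
Qed.

Lemma adj_norm_sqr x : `|x| ^+ 2 <= `|adj_mul (adj_star x) x|.
Proof.
set n := `|adj_mul _ _|; have n0 : 0 <= n by exact: normr_ge0.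
rewrite -[n]sqrtCK ler_pXn2r ?nnegrE ?sqrtC_ge0 //.
apply/adj_norm_le; first by rewrite sqrtC_ge0.
split=> [|b].
  rewrite -(ler_pXn2r (n := 2)) ?nnegrE ?sqrtC_ge0 // sqrtCK.
  have := adj_norm_scal (adj_mul (adj_star x) x).
  by rewrite /= normrM norm_conjC -expr2.
rewrite -(ler_pXn2r (n := 2)) ?nnegrE ?mulr_ge0 ?sqrtC_ge0 // exprMn sqrtCK.
rewrite -cstar_identity adj_lmul_star -adj_lmulM.
rewrite (le_trans (cnormM _ _)) // cnorm_star expr2 mulrCA ler_wpM2l //.
exact: adj_norm_lmul.
Qed.

Lemma adj_cstar_identity x : `|adj_mul (adj_star x) x| = `|x| ^+ 2.
Proof.
have le_star y : `|y| <= `|adj_star y|.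
  have [->|y0] := eqVneq y 0; first by rewrite normr0.
  rewrite -(ler_pM2r (x := `|y|)) ?normr_gt0 // -expr2.
  exact: le_trans (adj_norm_sqr y) (adj_normM _ _).
apply/eqP; rewrite eq_le adj_norm_sqr andbT expr2.
apply: le_trans (adj_normM _ _) _; rewrite ler_wpM2r //.
by rewrite -{2}(adj_starK x) le_star.
Qed.

HB.instance Definition _ := isCstarAlgebra.Build R adjoin_unit
  adj_mulA adj_mulDl adj_mulDr adj_mulZl adj_mulZr adj_starK adj_starD adj_starZ
  adj_starM adj_normM adj_cstar_identity.

Lemma adj_one_unit : is_unit adj_one.
Proof.
move=> [a k]; rewrite /cmul /= /adj_mul /=.
by rewrite cmul0l cmul0r !scale1r !scaler0 !addr0 !add0r mul1r mulr1.
Qed.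

Lemma adj_in_hom : is_star_hom adj_in.
Proof.
split=> [a b|k a|a b|a]; rewrite /adj_in.
- by congr pair; rewrite /= addr0.
- by congr pair; rewrite /= scaler0.
- by congr pair; rewrite /= ?scale0r ?addr0 ?mulr0.
- by congr pair; rewrite /= conjC0.
Qed.

End AdjoinUnit.
Section Unitization.
Variables (R : realType) (B : cstarType R).

Definition unitization : cstarType R :=
  if pselect (is_unital B) then B else adjoin_unit B.

Definition unitization_in : B -> unitization :=
  match pselect (is_unital B) as d
    return B -> (if d then B else adjoin_unit B : cstarType R) with
  | left _ => id
  | right _ => @adj_in R B
  end.

End Unitization.

(* [s] generates [B] and satisfies the relations [rel], and every family
   satisfying [rel] in a C*-algebra [B'] is the image of [s] under a
   *-homomorphism (which is then unique). *)
Definition is_universal (R : realType) (K : Type)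
    (rel : forall B : cstarType R, (K -> B) -> Prop)
    (B : cstarType R) (s : K -> B) : Prop :=
  [/\ rel B s,
      cstar_gen (range s) = setT &
      forall (B' : cstarType R) (t : K -> B'), rel B' t ->
        exists2 f : B -> B', is_star_hom f & forall k, f (s k) = t k].

Section ExelLaca.
Variables (R : realType) (I : choiceType) (A : I -> I -> bool).

Definition Aprod (X Y : {fset I}) (j : I) : nat :=
  (\prod_(x <- X) A x j * \prod_(y <- Y) (1 - A y j))%N.

(* [u] plays the role of the unit 1. The order of the factors in
   the products over [X] and [Y] is irrelevant when the S_i^* S_i commute. *)
Definition EL_relation1 (U : cstarType R) (u : U) (S : I -> U) : Prop :=
  forall X Y : {fset I}, finite_set [set j | Aprod X Y j != 0%N] ->
    \big[@cmul R U/u]_(x <- X) (star (S x) ** S x) **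
    \big[@cmul R U/u]_(y <- Y) (u - star (S y) ** S y) =
    \sum_(j \in [set: I]) (S j ** star (S j)) *+ Aprod X Y j.

(* Whether the unit has to be adjoined is decided in the C*-algebra generated
   by the family, which may be smaller than the ambient algebra [B]. The sum of
   this C*-algebra and C lies in [adjoin_unit B] and has the same unit. *)
Definition EL_relations (B : cstarType R) (S : I -> B) : Prop :=
  let gen := cstar_gen (range S) in
  let unit_of_gen e := gen e /\ forall a, gen a -> e ** a = a /\ a ** e = a in
  [/\ forall i, is_partial_isometry (S i),
      (forall e, unit_of_gen e -> EL_relation1 e S) /\
      (~ (exists e, unit_of_gen e) ->
        EL_relation1 (adj_one B) (fun i => adj_in (S i))),
      forall i j, (star (S i) ** S i) ** (star (S j) ** S j) =
                  (star (S j) ** S j) ** (star (S i) ** S i),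
      forall i j, i <> j -> star (S i) ** S j = 0 &
      forall i j, star (S i) ** S i ** S j = S j *+ A i j].

Definition is_exel_laca (O : cstarType R) (S : I -> O) : Prop :=
  is_universal EL_relations S.

End ExelLaca.

Section SystemAlgebra.
Variables (R : realType) (G : groupType) (T : Type) (X : set T).
Variable theta : partialAction G X.

Definition is_boolean_algebra (E : set (set T)) : Prop :=
  [/\ E X,
      forall V W, E V -> E W -> E (V `&` W),
      forall V W, E V -> E W -> E (V `|` W) &
      forall V, E V -> E (X `\` V)].

Definition system_boolean_algebra : set (set T) :=
  smallest is_boolean_algebra (range (pdom theta)).

Definition system_relations (B : cstarType R) (s : G -> B) : Prop :=
  let rproj g := s g ** star (s g) in
  [/\ (forall g, is_partial_isometry (s g)) /\
      (forall g h, rproj g ** rproj h = rproj h ** rproj g),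
      is_unit (s 1%g),
      forall g, s g^-1%g = star (s g),
      forall h i, s h ** s i = s h ** star (s h) ** s (h * i)%g &
      exists phi : set T -> B,
        [/\ forall g, phi (pdom theta g) = rproj g,
            forall V, system_boolean_algebra V ->
              cstar_gen (range rproj) (phi V) /\ is_projection (phi V),
            forall V W, system_boolean_algebra V -> system_boolean_algebra W ->
              phi (V `&` W) = phi V ** phi W,
            forall V W, system_boolean_algebra V -> system_boolean_algebra W ->
              phi (V `|` W) = phi V + phi W - phi V ** phi W &
            forall V, system_boolean_algebra V ->
              phi (X `\` V) = s 1%g - phi V]].

Definition is_system_algebra (C : cstarType R) (s : G -> C) : Prop :=
  is_universal system_relations s.

End SystemAlgebra.

(* Main.v *)
(* Both algebras are presented by the same data, so the two universal properties
   give maps in both directions which are inverse to each other on generators,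
   hence everywhere, because *-homomorphisms are continuous.

   From O_A to the system algebra: the domains of the letters a and a^-1 satisfy
   the Boolean identities behind the Exel-Laca relations. The delicate point is
   that 1 means the unit of the C*-algebra J generated by the s_i when J is
   unital; that this unit can only be s_e rests on the existence of a nontrivial
   representation, namely the one on the square summable functions on
   the Markov chain, with S_i u (x) = u (shift x) if x begins with i and 0
   otherwise.

   Conversely, given an Exel-Laca family, s_g is the product of the S_a and S_a^*
   along the reduced word of g. The range projections are values of Boolean
   expressions in the projections S_w S_b^* S_b S_w^*, and these define a Boolean
   homomorphism on the domains because an expression denoting the empty set has
   value 0: multiplying by S_a shortens the words w, and for empty words this is
   relation (1), the absence of zero rows making every cylinder nonempty. *)

From HB Require Import structures.
Require Import Defs.
From mathcomp Require Import all_boot all_order all_algebra finmap.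
From mathcomp Require Import ring.
From mathcomp Require Import complex.
From mathcomp Require Import all_classical all_reals all_analysis.
From mathcomp.analysis.showcase Require Import summability.

Set Implicit Arguments.
Unset Strict Implicit.
Unset Printing Implicit Defensive.

Import Order.TTheory GRing.Theory Num.Theory numFieldNormedType.Exports.

Local Open Scope classical_set_scope.
Local Open Scope ring_scope.

(* Relation (1) forces the unit into J only through an empty X: for nonempty X its left side lies in
   J whatever the unit, while for empty X it puts the unit into J. The difficulty is a J that has a
   unit other than that of the ambient algebra. This does occur for general families: take the
   identity matrix on an infinite index set, and let all S_i but one vanish, the remaining one being
   unitary in a proper direct summand. It must therefore be excluded for the universal family by
   comparison with a concrete one. The difference of the two units annihilates every S_i, but it is
   not visibly the projection of a Boolean expression; an approximation in norm replaces it by one.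
   What the representation then has to provide is that no nonempty Boolean expression annihilates
   every S_i, which is tested on single basis vectors. *)
#[local] Existing Instance totally_filter.

(** * Hilbert spaces and bounded operators *)

Section InnerProduct.
Variables (R : realType) (H : lmodType R[i]%C) (ip : H -> H -> R[i]%C).
Hypothesis ipDl : forall x y z, ip (x + y) z = ip x z + ip y z.
Hypothesis ipZl : forall k x z, ip (k *: x) z = k * ip x z.
Hypothesis ipC : forall x y, ip y x = (ip x y)^*%R.
Hypothesis ip_ge0 : forall x, 0 <= ip x x.
Hypothesis ip_eq0 : forall x, ip x x = 0 -> x = 0.

Let ipDr z u v : ip z (u + v) = ip z u + ip z v.
Proof. by rewrite ipC ipDl rmorphD /= -!ipC. Qed.

Let ipZr k u v : ip u (k *: v) = k^*%R * ip u v.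
Proof. by rewrite ipC ipZl rmorphM /= -ipC. Qed.

Lemma form_CauchySchwarz x y : `|ip x y| ^+ 2 <= ip x x * ip y y.
Proof.
have [->|y0] := eqVneq y 0.
  by rewrite -(scale0r (0 : H)) ipZr ipZl conjC0 !mul0r normr0 expr0n mulr0.
have yy0 : 0 < ip y y.
  by rewrite lt_def ip_ge0 andbT; apply: contra_neq y0 => /ip_eq0.
(* This vector is [ip y y] times the component of x orthogonal to y; clearing the denominator keeps
   the expansion polynomial. *)
have := ip_ge0 (ip y y *: x + (- ip x y) *: y).
have -> : ip (ip y y *: x + (- ip x y) *: y) (ip y y *: x + (- ip x y) *: y) =
    ip y y * (ip x x * ip y y - `|ip x y| ^+ 2).
  rewrite ipDl !ipDr !ipZl !ipZr normCK rmorphN -(ipC y y) (ipC x y).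
  by ring.
by rewrite pmulr_rge0 // subr_ge0.
Qed.

Definition form_norm x := sqrtC (ip x x).

Lemma form_norm_ge0 x : 0 <= form_norm x.
Proof. by rewrite sqrtC_ge0. Qed.

Lemma form_CauchySchwarz_norm x y : `|ip x y| <= form_norm x * form_norm y.
Proof.
rewrite -(ler_pXn2r (n := 2)) ?nnegrE ?mulr_ge0 ?form_norm_ge0 //.
by rewrite exprMn !sqrtCK form_CauchySchwarz.
Qed.

Lemma form_normD x y : form_norm (x + y) <= form_norm x + form_norm y.
Proof.
rewrite -(ler_pXn2r (n := 2)) ?nnegrE ?addr_ge0 ?form_norm_ge0 //.
rewrite sqrrD !sqrtCK ipDl !ipDr (ipC x y) -addrA [leRHS]addrAC -[leRHS]addrA.
rewrite lerD2l addrA [leRHS]addrC lerD2r.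
have r : ip x y + (ip x y)^*%R \is Num.real.
  by rewrite CrealE rmorphD /= conjCK addrC.
apply: le_trans (real_ler_norm r) _; apply: le_trans (ler_normD _ _) _.
by rewrite norm_conjC mulr2n lerD // form_CauchySchwarz_norm.
Qed.

Lemma form_normZ k x : form_norm (k *: x) = `|k| * form_norm x.
Proof.
apply: (pexpIrn (n := 2)); rewrite ?nnegrE ?mulr_ge0 ?form_norm_ge0 //.
by rewrite exprMn !sqrtCK ipZl ipZr normCK mulrA.
Qed.

Lemma form_norm_eq0 x : form_norm x = 0 -> x = 0.
Proof. by move/eqP; rewrite sqrtC_eq0 => /eqP/ip_eq0. Qed.

End InnerProduct.

HB.mixin Record isHilbert (R : realType) H & CompleteNormedModule R[i]%C H := {
  ip : H -> H -> R[i]%C;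
  ipDl : forall x y z, ip (x + y) z = ip x z + ip y z;
  ipZl : forall k x z, ip (k *: x) z = k * ip x z;
  ipC : forall x y, ip y x = (ip x y)^*%R;
  ip_norm : forall x, ip x x = `|x| ^+ 2
}.

#[short(type="hilbertType")]
HB.structure Definition Hilbert (R : realType) :=
  { H of isHilbert R H & CompleteNormedModule R[i]%C H }.

Section HilbertTheory.
Variables (R : realType) (H : hilbertType R).
Implicit Types x y z : H.

Lemma ipDr z x y : ip z (x + y) = ip z x + ip z y.
Proof. by rewrite ipC ipDl rmorphD /= -!ipC. Qed.

Lemma ipZr k x y : ip x (k *: y) = k^*%R * ip x y.
Proof. by rewrite ipC ipZl rmorphM /= -ipC. Qed.

Lemma ipBl x y z : ip (x - y) z = ip x z - ip y z.
Proof. by rewrite ipDl -scaleN1r ipZl mulN1r. Qed.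

Lemma ipBr z x y : ip z (x - y) = ip z x - ip z y.
Proof. by rewrite ipC ipBl rmorphB /= -!ipC. Qed.

Lemma ip_eq0 x : ip x x = 0 -> x = 0.
Proof. by rewrite ip_norm => /eqP; rewrite expf_eq0 normr_eq0 => /andP[_ /eqP]. Qed.

Lemma ip_CauchySchwarz x y : `|ip x y| <= `|x| * `|y|.
Proof.
have := @form_CauchySchwarz _ _ _ (@ipDl R H) (@ipZl R H) (@ipC R H) _ ip_eq0 x y.
rewrite !ip_norm -exprMn ler_pXn2r ?nnegrE ?mulr_ge0 //; apply => z.
by rewrite ip_norm exprn_ge0.
Qed.

Lemma ip_ext x y : (forall z, ip x z = ip y z) -> x = y.
Proof. by move=> e; apply/subr0_eq/ip_eq0; rewrite ipBl e subrr. Qed.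

End HilbertTheory.

Section BoundedOperators.
Variables (R : realType) (H : hilbertType R).
Local Notation C := (R[i]%C).
Implicit Types x y : H.

Definition is_adjoint (T T' : H -> H) := forall x y, ip (T x) y = ip x (T' y).

Definition is_bounded (T : H -> H) := exists k : C, forall x, `|T x| <= k * `|x|.

(** With an adjoint required from the start, linearity is automatic ([adjoint_linear]) and the
    involution exists without the Riesz representation theorem. *)
Definition adjointable : {pred H -> H} :=
  fun T => `[< (exists T', is_adjoint T T') /\ is_bounded T >].

Lemma adjoint_linear T T' : is_adjoint T T' ->
  forall k x y, T (k *: x + y) = k *: T x + T y.
Proof. by move=> a k x y; apply: ip_ext => z; rewrite a !(ipDl, ipZl) !a. Qed.

Lemma adjoint_sym T T' : is_adjoint T T' -> is_adjoint T' T.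
Proof. by move=> a x y; rewrite ipC -a -ipC. Qed.

Lemma adjoint_bound T T' (k : C) : 0 <= k -> is_adjoint T T' ->
  (forall x, `|T x| <= k * `|x|) -> forall x, `|T' x| <= k * `|x|.
Proof.
move=> k0 a b x; have [->|n0] := eqVneq (T' x) 0.
  by rewrite normr0 mulr_ge0.
rewrite -(ler_pM2r (x := `|T' x|)) ?normr_gt0 // -expr2 -ip_norm -a.
rewrite -[leLHS]ger0_norm ?a ?ip_norm ?exprn_ge0 // -ip_norm -a.
by rewrite (le_trans (ip_CauchySchwarz _ _)) // mulrAC ler_wpM2r.
Qed.

Lemma bounded_ge0 T : is_bounded T ->
  exists2 k : C, 0 <= k & forall x, `|T x| <= k * `|x|.
Proof.
move=> [k b]; exists `|k| => // x; apply: le_trans (b x) _.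
have kr : k * `|x| \is Num.real by apply: ger0_real; apply: le_trans (b x).
by apply: le_trans (real_ler_norm kr) _; rewrite normrM normr_id.
Qed.

Lemma adjointable_submod : submod_closed adjointable.
Proof.
split=> [|k T U].
  apply/asboolP; split.
    by exists 0 => x y; rewrite -(scale0r 0) ipZl ipZr conjC0 !mul0r.
  by exists 0 => x; rewrite normr0 mul0r.
move=> /asboolP[[T' aT] [t bT]] /asboolP[[U' aU] [u bU]]; apply/asboolP; split.
  by exists (k^*%R *: T' + U') => x y; rewrite ipDl ipZl ipDr ipZr conjCK aT aU.
exists (`|k| * t + u) => x; apply: le_trans (ler_normD _ _) _.
by rewrite mulrDl lerD // normrZ -mulrA ler_wpM2l.
Qed.

HB.instance Definition _ :=
  GRing.isSubmodClosed.Build C (H -> H) adjointable adjointable_submod.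

Record operator := Operator { opfun :> H -> H; opfunP : opfun \in adjointable }.

HB.instance Definition _ := [isSub for opfun].
HB.instance Definition _ := [Choice of operator by <:].
HB.instance Definition _ := [SubChoice_isSubLmodule of operator by <:].

Implicit Types S T U : operator.

Lemma op_adjoint T : exists T' : H -> H, is_adjoint T T'.
Proof. by have /asboolP[e _] := opfunP T; exact: e. Qed.

Lemma op_bounded T : is_bounded T.
Proof. by have /asboolP[_ b] := opfunP T; exact: b. Qed.

Lemma op_ext S T : (forall x, S x = T x) -> S = T.
Proof. by move=> e; apply: val_inj; apply/funext. Qed.

Lemma op_linear T k x y : T (k *: x + y) = k *: T x + T y.
Proof. by have [T' /adjoint_linear] := op_adjoint T. Qed.

Lemma opD T x y : T (x + y) = T x + T y.
Proof. by rewrite -(scale1r x) op_linear !scale1r. Qed.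

Lemma op0 T : T 0 = 0.
Proof. by apply: (addIr (T 0)); rewrite -opD !add0r. Qed.

Lemma opZ T k x : T (k *: x) = k *: T x.
Proof. by rewrite -[k *: x]addr0 op_linear op0 addr0. Qed.

Definition op_rnorms T : set R :=
  [set complex.Re `|T x| | x in [set x : H | `|x| <= 1]].

Definition op_norm T : C := (sup (op_rnorms T))%:C%C.

Lemma op_rnorms_has_sup T : has_sup (op_rnorms T).
Proof.
split; first by exists (complex.Re `|T 0|), 0; rewrite //= normr0.
have [k k0 b] := bounded_ge0 (op_bounded T); exists (complex.Re k).
move=> _ [x /= x1 <-]; rewrite -lecR !ReK //.
by apply: le_trans (b x) _; rewrite ler_piMr.
Qed.

Lemma op_norm_le T (k : C) : 0 <= k ->
  op_norm T <= k <-> forall x, `|T x| <= k * `|x|.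
Proof.
move=> k0; rewrite -{1}(ReK k0) lecR; split=> [k1 x|k1].
  have [->|x0] := eqVneq x 0; first by rewrite op0 !normr0 mulr0.
  have n0 : 0 < `|x| by rewrite normr_gt0.
  have : op_rnorms T (complex.Re `|T (`|x|^-1 *: x)|).
    by exists (`|x|^-1 *: x) => //=; rewrite normfZV.
  move/(ub_le_sup (proj2 (op_rnorms_has_sup T)))/le_trans/(_ k1).
  rewrite -lecR !ReK // opZ normrZ normfV normr_id.
  by rewrite mulrC ler_pdivrMr.
apply: ge_sup; first by case: (op_rnorms_has_sup T).
move=> _ [x /= x1 <-]; rewrite -lecR !ReK //.
by apply: le_trans (k1 x) _; rewrite ler_piMr.
Qed.

Lemma op_norm_ge0 T : 0 <= op_norm T.
Proof.
rewrite ler0c; apply: le_trans (ub_le_sup (proj2 (op_rnorms_has_sup T)) _).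
  2: by exists 0; rewrite //= normr0.
by rewrite -ler0c ReK.
Qed.

Lemma op_norm_apply T x : `|T x| <= op_norm T * `|x|.
Proof. by have /op_norm_le := lexx (op_norm T); apply; exact: op_norm_ge0. Qed.

Lemma op_normD S T : op_norm (S + T) <= op_norm S + op_norm T.
Proof.
apply/op_norm_le => [|x]; first by rewrite addr_ge0 ?op_norm_ge0.
rewrite mulrDl; apply: le_trans (ler_normD _ _) _.
by rewrite lerD ?op_norm_apply.
Qed.

Lemma op_normZ_le (k : C) T : op_norm (k *: T) <= `|k| * op_norm T.
Proof.
apply/op_norm_le => [|x]; first by rewrite mulr_ge0 ?op_norm_ge0.
by rewrite [(k *: T) x]/(k *: T x) normrZ -mulrA ler_wpM2l ?op_norm_apply.
Qed.

Lemma op_normZ (k : C) T : op_norm (k *: T) = `|k| * op_norm T.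
Proof.
apply/eqP; rewrite eq_le op_normZ_le /=.
have [->|k0] := eqVneq k 0; first by rewrite normr0 mul0r op_norm_ge0.
rewrite -ler_pdivlMl ?normr_gt0 // -normfV -{1}(scalerK k0 T).
exact: op_normZ_le.
Qed.

Lemma op_norm_eq0 T : op_norm T = 0 -> T = 0.
Proof.
move=> T0; apply: op_ext => x; apply/eqP; rewrite -normr_le0.
by have := op_norm_apply T x; rewrite T0 mul0r.
Qed.

HB.instance Definition _ := Lmodule_isNormed.Build C operator
  op_normD op_normZ op_norm_eq0.

Lemma comp_adjointable S T : (fun x => S (T x)) \in adjointable.
Proof.
have [S' aS] := op_adjoint S; have [T' aT] := op_adjoint T.
apply/asboolP; split; first by exists (T' \o S') => x y; rewrite aS aT.
exists (op_norm S * op_norm T) => x; apply: le_trans (op_norm_apply _ _) _.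
by rewrite -mulrA ler_wpM2l ?op_norm_ge0 ?op_norm_apply.
Qed.

Definition op_mul S T := Operator (comp_adjointable S T).

Lemma adjoint_adjointable T :
  sval (cid (op_adjoint T)) \in adjointable.
Proof.
case: (cid _) => T' aT /=; apply/asboolP; split.
  by exists T; exact: adjoint_sym.
exists (op_norm T) => x; apply: adjoint_bound aT _ x; first exact: op_norm_ge0.
exact: op_norm_apply.
Qed.

Definition op_star T := Operator (adjoint_adjointable T).

Lemma op_starP T : is_adjoint T (op_star T).
Proof. exact: svalP (cid (op_adjoint T)). Qed.

Lemma op_star_eq T (T' : H -> H) : is_adjoint T T' -> op_star T = T' :> (H -> H).
Proof.
move=> a; apply/funext => x; apply: ip_ext => y.
by rewrite (adjoint_sym a) (adjoint_sym (op_starP T)).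
Qed.

Lemma op_star_norm T : op_norm (op_star T) <= op_norm T.
Proof.
apply/op_norm_le => [|x]; first exact: op_norm_ge0.
apply: adjoint_bound (op_starP T) _ x; first exact: op_norm_ge0.
exact: op_norm_apply.
Qed.

Lemma op_starK : involutive op_star.
Proof.
by move=> T; apply: val_inj; apply: op_star_eq; apply/adjoint_sym/op_starP.
Qed.

Lemma op_starD : {morph op_star : S T / S + T}.
Proof.
move=> S T; apply: val_inj; apply: op_star_eq => x y.
by rewrite ipDl ipDr !op_starP.
Qed.

Lemma op_starZ (k : C) T : op_star (k *: T) = (k^*)%R *: op_star T.
Proof.
apply: val_inj; apply: op_star_eq => x y.
by rewrite ipZl ipZr conjCK op_starP.
Qed.

Lemma op_starM S T : op_star (op_mul S T) = op_mul (op_star T) (op_star S).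
Proof.
apply: val_inj; apply: op_star_eq => x y.
exact: etrans (op_starP S _ _) (op_starP T _ _).
Qed.

(** A Cauchy filter of operators converges pointwise, and so do the adjoints because [op_star] does
    not increase norms. The two pointwise limits are adjoint to each other by continuity of the
    inner product, so the limit is again an operator. *)
Lemma op_complete (F : set_system operator) :
  ProperFilter F -> cauchy F -> cvg F.
Proof.
move=> FF /cauchyP Fc.
have comp (f : operator -> operator) x :
    (forall S T, `|f S x - f T x| <= `|S - T| * `|x|) ->
    exists l : H, (fun T => f T x) @ F --> l.
  move=> fle; apply/cvg_ex; apply: cauchy_cvg.
  apply/cauchyP => e e0; have x1 : 0 < `|x| + 1 by rewrite ltr_wpDl.
  have [|T FT] := Fc (e / (`|x| + 1)); first by rewrite divr_gt0.
  exists (f T x); change (F ((fun T => f T x) @^-1` ball (f T x) e)).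
  apply: filterS FT => S; rewrite -!ball_normE /= => TS.
  apply: le_lt_trans (fle _ _) _; rewrite -[ltRHS](divfK (lt0r_neq0 x1)).
  apply: le_lt_trans (_ : _ <= `|T - S| * (`|x| + 1)) _.
    by rewrite ler_wpM2l // lerDl.
  by rewrite ltr_pM2r.
have op_le S x : `|S x| <= `|S| * `|x| by exact: op_norm_apply.
have /choice[L FL] x : exists l : H, (fun T : operator => T x) @ F --> l.
  apply: (comp id) => S T; exact: op_le (S - T) x.
have /choice[L' FL'] x : exists l : H, (fun T => op_star T x) @ F --> l.
  apply: comp => S T; apply: le_trans (op_le (op_star S - op_star T) x) _.
  rewrite ler_wpM2r // -scaleN1r -(conjCN1) -op_starZ -op_starD scaleN1r.
  exact: op_star_norm.
have LL' : is_adjoint L L'.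
  move=> x y; apply/subr0_eq/eqP; rewrite -normr_le0.
  apply/ler_addgt0Pr => e e0; rewrite add0r.
  have d1 : 0 < `|x| + `|y| + 1 by rewrite ltr_wpDl ?addr_ge0.
  have d0 : 0 < e / (`|x| + `|y| + 1) by rewrite divr_gt0.
  move: (FL x) (FL' y) => /cvgrPdist_lt/(_ _ d0) F1 /cvgrPdist_lt/(_ _ d0) F2.
  have [T [xT yT]] := filter_ex (filterI F1 F2).
  rewrite -(subrK (ip (T x) y) (ip (L x) y)) -addrA {2}op_starP -ipBl -ipBr.
  apply: le_trans (ler_normD _ _) _.
  apply: le_trans (lerD (ip_CauchySchwarz _ _) (ip_CauchySchwarz _ _)) _.
  rewrite -[leRHS](divfK (lt0r_neq0 d1)) mulrDr mulrDr mulr1 -addrA.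
  rewrite addrCA -[leLHS]addr0 -addrA lerD //; first by rewrite ler_wpM2r // ltW.
  rewrite lerD ?(ltW d0) // mulrC distrC ler_wpM2r // ltW //.
(* The Cauchy estimate passes to the pointwise limit, uniformly on the unit ball; this gives both
   boundedness of L and convergence in norm. *)
have near_le T e : 0 < e -> F (ball T e) -> forall x, `|L x - T x| <= e * `|x|.
  move=> e0 FT x; apply/ler_addgt0Pr => d d0.
  move: (FL x) => /cvgrPdist_lt/(_ _ d0) F1.
  have [S [xS]] := filter_ex (filterI F1 FT); rewrite -ball_normE /= => TS.
  rewrite -(subrK (S x) (L x)) -addrA addrC (le_trans (ler_normD _ _)) //.
  rewrite lerD ?(ltW xS) // distrC.
  by apply: le_trans (op_le (T - S) x) _; rewrite ler_wpM2r // ltW.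
have LP : L \in adjointable.
  apply/asboolP; split; first by exists L'.
  have [T FT] := Fc 1 ltr01; exists (1 + `|T|) => x.
  rewrite -(subrK (T x) (L x)) mulrDl (le_trans (ler_normD _ _)) // lerD //.
  exact: near_le.
apply/cvg_ex; exists (Operator LP); apply/cvgrPdist_lt => /= e e0.
have e2 : 0 < e / 2 by rewrite divr_gt0.
have [T FT] := Fc (e / 2) e2; have LT := near_le _ _ e2 FT.
apply: filterS FT => S; rewrite -ball_normE /= => TS.
rewrite -(subrK T (Operator LP)) -addrA [e]splitr.
apply: le_lt_trans (ler_normD _ _) _; apply: ler_ltD => //.
by apply/op_norm_le; rewrite ?(ltW e2).
Qed.

HB.instance Definition _ := Uniform_isComplete.Build operator op_complete.

Lemma op_mulA : associative op_mul.
Proof. by move=> S T U; apply: op_ext. Qed.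

Lemma op_mulDl : left_distributive op_mul +%R.
Proof. by move=> S T U; apply: op_ext. Qed.

Lemma op_mulDr : right_distributive op_mul +%R.
Proof. by move=> S T U; apply: op_ext => x; exact: opD. Qed.

Lemma op_mulZl (k : C) S T : op_mul (k *: S) T = k *: op_mul S T.
Proof. by apply: op_ext. Qed.

Lemma op_mulZr (k : C) S T : op_mul S (k *: T) = k *: op_mul S T.
Proof. by apply: op_ext => x; exact: opZ. Qed.

Lemma op_normM S T : `|op_mul S T| <= `|S| * `|T|.
Proof.
apply/op_norm_le => [|x]; first by rewrite mulr_ge0 ?op_norm_ge0.
apply: le_trans (op_norm_apply S (T x)) _.
by rewrite -mulrA ler_wpM2l ?op_norm_ge0 ?op_norm_apply.
Qed.

Lemma op_cstar_identity T : `|op_mul (op_star T) T| = `|T| ^+ 2.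
Proof.
apply/eqP; rewrite eq_le expr2 (le_trans (op_normM _ _)) /=; last first.
  by rewrite ler_wpM2r ?op_norm_ge0 ?op_star_norm.
set n := `|op_mul _ _|; have n0 : 0 <= n by exact: normr_ge0.
rewrite -expr2 -[n]sqrtCK ler_pXn2r ?nnegrE ?sqrtC_ge0 //.
apply/op_norm_le => [|x]; first by rewrite sqrtC_ge0.
rewrite -(ler_pXn2r (n := 2)) ?nnegrE ?mulr_ge0 ?sqrtC_ge0 // exprMn sqrtCK.
rewrite -ip_norm op_starP -[leLHS]ger0_norm -?op_starP ?ip_norm ?exprn_ge0 //.
rewrite -ip_norm op_starP (le_trans (ip_CauchySchwarz _ _)) //.
by rewrite expr2 mulrCA ler_wpM2l //; 
exact: op_norm_apply (op_mul (op_star T) T) x.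
Qed.

HB.instance Definition _ := isCstarAlgebra.Build R operator
  op_mulA op_mulDl op_mulDr op_mulZl op_mulZr op_starK op_starD op_starZ
  op_starM op_normM op_cstar_identity.

End BoundedOperators.

(** * Square summable functions *)

Section ComplexLimits.
Variables (R : realType) (T : Type) (F : set_system T).
Hypothesis FF : ProperFilter F.
Local Notation C := (R[i]%C).
Implicit Types (f : T -> C^o) (l k : C^o).

Lemma cvg_conjC f l : f @ F --> l -> (fun t => (f t)^*%R : C^o) @ F --> (l^*%R : C^o).
Proof.
move=> /cvgrPdist_lt fl; apply/cvgrPdist_lt => e e0.
by apply: filterS (fl e e0) => t; rewrite -rmorphB norm_conjC.
Qed.

Lemma cvgC_ge0 f l : f @ F --> l -> (\forall t \near F, 0 <= f t) -> 0 <= l.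
Proof.
move=> /cvgrPdist_lt fl f0; suff -> : l = `|l| by [].
apply/subr0_eq/eqP; rewrite -normr_le0; apply/ler_addgt0Pr => e e0.
have e2 : 0 < e / 2 by rewrite divr_gt0.
have [t [lt ft]] := filter_ex (filterI (fl _ e2) f0).
rewrite add0r -(subrK (f t) l) -addrA (le_trans (ler_normD _ _)) //.
rewrite [e]splitr lerD ?(ltW lt) // subrK -{1}(ger0_norm ft).
by rewrite (le_trans (ler_dist_dist _ _)) // distrC ltW.
Qed.

Lemma cvgC_le f l k : f @ F --> l -> (\forall t \near F, f t <= k) -> l <= k.
Proof.
move=> fl fk; rewrite -subr_ge0; apply: (@cvgC_ge0 (fun t => k - f t) (k - l)).
  exact: cvgB (cvg_cst k) fl.
by apply: filterS fk => t; rewrite subr_ge0.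
Qed.

End ComplexLimits.

Section SquareSummable.
Variables (R : realType) (E : choiceType).
Local Notation C := (R[i]%C).
Implicit Types (a b : E -> C) (A : {fset E}).

Definition psum a A : C^o := \sum_(x <- A) a x.

Lemma psum_ge0 a A : (forall x, 0 <= a x) -> 0 <= psum a A.
Proof. by move=> a0; apply: sumr_ge0. Qed.

Lemma psum_mono a A B : (forall x, 0 <= a x) -> fsubset A B ->
  psum a A <= psum a B.
Proof.
move=> a0 /fsubsetP AB; rewrite /psum [leRHS](bigID (mem A)) /=.
rewrite -[\sum_(x <- B | x \in A) _]big_filter.
rewrite [X in _ <= X + _](perm_big (enum_fset A)); last first.
  apply: uniq_perm; rewrite ?filter_uniq ?fset_uniq // => x.
  by rewrite mem_filter andb_idr //; exact: AB.
by rewrite lerDl sumr_ge0.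
Qed.

Lemma psum_linear (k : C) a b A :
  psum (fun x => k * a x + b x) A = k * psum a A + psum b A.
Proof. by rewrite /psum big_split mulr_sumr. Qed.

(** Partial sums of nonnegative terms increase along inclusion of finite sets, so they converge to
    their supremum. *)
Lemma psum_bounded_cvg a k : (forall x, 0 <= a x) ->
  (forall A, psum a A <= k) -> cvg (psum a @ totally).
Proof.
move=> a0 ak; pose r A := complex.Re (psum a A).
have rE A : (r A)%:C%C = psum a A by rewrite ReK // psum_ge0.
have r_sup : has_sup (range r).
  split; first by exists (r fset0), fset0.
  exists (complex.Re k) => _ [A _ <-]; rewrite -lecR rE ReK //.
  by rewrite (le_trans _ (ak fset0)) // psum_ge0.
apply/cvg_ex; exists ((sup (range r))%:C%C : C^o); apply/cvgrPdist_lt => e e0.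
have eE := ReK (ltW e0); have d0 : 0 < complex.Re e by rewrite -ltcR eE.
have [_ [A _ <-] rA] := sup_adherent d0 r_sup.
exists A => // B /= AB; rewrite -rE -rmorphB -eE ger0_norm ?ler0c ?ltcR.
  rewrite ltrBlDl -ltrBlDr (lt_le_trans rA) // -lecR !rE.
  exact: psum_mono.
rewrite subr_ge0; apply: ub_le_sup; first by case: r_sup.
by exists B.
Qed.

Definition square_summable : {pred E -> C^o} :=
  fun a => `[< exists k, forall A, psum (fun x => `|a x| ^+ 2) A <= k >].

Lemma square_summable_submod : submod_closed square_summable.
Proof.
split=> [|k a b].
  by apply/asboolP; exists 0 => A; rewrite /psum big1 // => x _; rewrite normr0 expr0n.
move=> /asboolP[ka aP] /asboolP[kb bP]; apply/asboolP.
exists (2 * `|k| ^+ 2 * ka + 2 * kb) => A.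
apply: le_trans (_ : _ <= psum (fun x => (2 * `|k| ^+ 2) * `|a x| ^+ 2
    + 2 * `|b x| ^+ 2) A) _.
  apply: ler_sum => x _; rewrite -[(k *: a + b) x]/(k * a x + b x).
  (* Parallelogram law: dropping the second square bounds |u + v|^2 by 2|u|^2 + 2|v|^2, the origin
     of the factors 2 above. *)
  have p (u v : C) : `|u + v| ^+ 2 + `|u - v| ^+ 2 = 2 * `|u| ^+ 2 + 2 * `|v| ^+ 2.
    by rewrite !normCK !(rmorphD, rmorphN) /=; ring.
  rewrite -mulrA -exprMn -normrM -p lerDl exprn_ge0 //.
rewrite psum_linear [X in _ + X](_ : _ = 2 * psum (fun x => `|b x| ^+ 2) A); last first.
  by rewrite /psum mulr_sumr.
by rewrite lerD // ler_wpM2l // mulr_ge0 // exprn_ge0.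
Qed.

HB.instance Definition _ := GRing.isSubmodClosed.Build C (E -> C^o)
  square_summable square_summable_submod.

Record l2 := L2 { l2fun :> E -> C^o; l2funP : l2fun \in square_summable }.

HB.instance Definition _ := [isSub for l2fun].
HB.instance Definition _ := [Choice of l2 by <:].
HB.instance Definition _ := [SubChoice_isSubLmodule of l2 by <:].

Implicit Types u v w : l2.

Lemma l2_ext u v : (forall x, u x = v x) -> u = v.
Proof. by move=> e; apply: val_inj; apply/funext. Qed.

Lemma l2_sqr_cvg u : cvg (psum (fun x => `|u x| ^+ 2) @ totally).
Proof.
have /asboolP[k uk] := l2funP u.
by apply: psum_bounded_cvg uk => x; rewrite exprn_ge0.
Qed.

Definition l2_ip u v : C^o := lim (psum (fun x => u x * (v x)^*%R) @ totally).

(* Reduces the convergence of the sums defining the inner product to that of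
   bounded sums of nonnegative terms. *)
Lemma polarization (x y : C) : x * y^*%R = 4^-1 * `|x + y| ^+ 2 +
  (- 4^-1 * `|x - y| ^+ 2 +
   (4^-1 * 'i * `|x + 'i * y| ^+ 2 + (- 4^-1 * 'i) * `|x - 'i * y| ^+ 2)).
Proof.
rewrite !normCK !(rmorphD, rmorphN, rmorphM) /= conjCi.
have i2 : 'i * 'i = -1 :> C by rewrite -expr2 sqrCi.
have h4 : 4 * 4^-1 = 1 :> C by rewrite divff ?pnatr_eq0.
rewrite -[LHS]mul1r -{1}h4; move: 4^-1 => h in h4 *.
move: 'i (x^*)%R (y^*)%R i2 => t p q i2; ring: i2.
Qed.

Lemma l2_ip_cvg u v : psum (fun x => u x * (v x)^*%R) @ totally --> l2_ip u v.
Proof.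
suff : cvg (psum (fun x => u x * (v x)^*%R) @ totally) by [].
have -> : psum (fun x => u x * (v x)^*%R) = fun A =>
    4^-1 * psum (fun x => `|(u + v) x| ^+ 2) A +
    (- 4^-1 * psum (fun x => `|(u - v) x| ^+ 2) A +
     (4^-1 * 'i * psum (fun x => `|(u + 'i *: v) x| ^+ 2) A +
      (- 4^-1 * 'i) * psum (fun x => `|(u - 'i *: v) x| ^+ 2) A)).
  apply/funext => A; rewrite /psum !mulr_sumr -!big_split /=.
  by apply: eq_bigr => x _; exact: polarization.
have cvgM' (k : C^o) w :
    cvg ((fun A => k * psum (fun x => `|w x| ^+ 2) A : C^o) @ totally).
  by apply: is_cvgM; [exact: is_cvg_cst|exact: l2_sqr_cvg].
by do 3 apply: is_cvgD => //.
Qed.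

Lemma l2_ip_unique u v l :
  psum (fun x => u x * (v x)^*%R) @ totally --> l -> l2_ip u v = l.
Proof. by move=> h; apply: cvg_lim h; exact: norm_hausdorff. Qed.

Lemma l2_ipDl u v w : l2_ip (u + v) w = l2_ip u w + l2_ip v w.
Proof.
apply: l2_ip_unique.
have -> : psum (fun x => (u + v) x * (w x)^*%R) =
    psum (fun x => u x * (w x)^*%R) + psum (fun x => v x * (w x)^*%R).
  apply/funext => A.
  rewrite -[RHS]/(psum (fun x => u x * (w x)^*%R) A + psum _ A) /psum -big_split.
  by apply: eq_bigr => x _; exact: mulrDl.
exact: cvgD (@l2_ip_cvg u w) (@l2_ip_cvg v w).
Qed.

Lemma l2_ipZl (k : C) u w : l2_ip (k *: u) w = k * l2_ip u w.
Proof.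
apply: l2_ip_unique.
have -> : psum (fun x => (k *: u) x * (w x)^*%R) =
    fun A => (k : C^o) * psum (fun x => u x * (w x)^*%R) A.
  apply/funext => A; rewrite /psum mulr_sumr.
  by apply: eq_bigr => x _; rewrite mulrA.
exact: cvgM (cvg_cst _) (@l2_ip_cvg u w).
Qed.

Lemma l2_ipC u v : l2_ip v u = (l2_ip u v)^*%R.
Proof.
apply: l2_ip_unique.
have -> : psum (fun x => v x * (u x)^*%R) =
    fun A => ((psum (fun x => u x * (v x)^*%R) A)^*%R : C^o).
  apply/funext => A; rewrite /psum rmorph_sum.
  by apply: eq_bigr => x _; rewrite rmorphM /= conjCK mulrC.
exact: cvg_conjC (@l2_ip_cvg u v).
Qed.

Lemma l2_psum_le u A : psum (fun x => `|u x| ^+ 2) A <= l2_ip u u.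
Proof.
rewrite -subr_ge0.
apply: (@cvgC_ge0 _ _ totally (@totally_filter E)
    (fun B => psum (fun x => u x * (u x)^*%R) B -
    psum (fun x => `|u x| ^+ 2) A) (l2_ip u u - psum (fun x => `|u x| ^+ 2) A)).
  exact: cvgB (@l2_ip_cvg u u) (cvg_cst _).
exists A => // B /= AB; rewrite subr_ge0 [leRHS](_ : _ = psum (fun x => `|u x| ^+ 2) B).
  by apply: psum_mono => // x; rewrite exprn_ge0.
by apply: eq_bigr => x _; rewrite normCK.
Qed.

Lemma l2_ip_le u (k : C) : (forall A, psum (fun x => `|u x| ^+ 2) A <= k) ->
  l2_ip u u <= k.
Proof.
move=> uk; apply: cvgC_le (@l2_ip_cvg u u) _; apply: nearW => A.
by rewrite (le_trans _ (uk A)) // ler_sum // => x _; rewrite normCK.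
Qed.

Lemma l2_ip_ge0 u : 0 <= l2_ip u u.
Proof. by apply: le_trans (l2_psum_le u fset0); rewrite /psum big_nil. Qed.

Lemma l2_sqr_le u x : `|u x| ^+ 2 <= l2_ip u u.
Proof. by apply: le_trans (l2_psum_le u [fset x]%fset); rewrite /psum big_seq_fset1. Qed.

Lemma l2_ip_eq0 u : l2_ip u u = 0 -> u = 0.
Proof.
move=> u0; apply: l2_ext => x; apply/eqP; rewrite -normr_le0.
have := l2_sqr_le u x; rewrite u0 => h.
by rewrite -(ler_pXn2r (n := 2)) ?nnegrE // expr0n.
Qed.

HB.instance Definition _ := Lmodule_isNormed.Build C l2
  (form_normD l2_ipDl l2_ipZl l2_ipC l2_ip_ge0 l2_ip_eq0)
  (form_normZ l2_ipZl l2_ipC l2_ip_ge0)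
  (form_norm_eq0 l2_ip_eq0).

Lemma l2_ip_norm u : l2_ip u u = `|u| ^+ 2.
Proof. exact: esym (sqrtCK _). Qed.

Lemma l2_coord_le u x : `|u x| <= `|u|.
Proof.
by rewrite -(ler_pXn2r (n := 2)) ?nnegrE // -l2_ip_norm l2_sqr_le.
Qed.

Lemma l2_complete (F : set_system l2) : ProperFilter F -> cauchy F -> cvg F.
Proof.
move=> FF /cauchyP Fc.
have /choice[L FL] x : exists l : C^o, (fun u : l2 => u x) @ F --> l.
  apply/cvg_ex; apply: complex_complete; apply/cauchyP => e e0.
  have [u Fu] := Fc e e0.
  exists (u x); change (F ((fun u : l2 => u x) @^-1` ball (u x) e)).
  apply: filterS Fu => v; rewrite -!ball_normE /= => uv.
  exact: le_lt_trans (l2_coord_le (u - v) x) uv.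
(* On a fixed finite set the estimate involves finitely many coordinates and passes to the limit; as
   the bound does not depend on A, it is an estimate in norm. *)
have near_le u e A : 0 < e -> F (ball u e) ->
    psum (fun x => `|L x - u x| ^+ 2) A <= e ^+ 2.
  move=> e0 Fu; apply: (@cvgC_le _ _ F _
      (fun v : l2 => psum (fun x => `|v x - u x| ^+ 2) A)
      (psum (fun x => `|L x - u x| ^+ 2) A)); last first.
    apply: filterS Fu => v; rewrite -ball_normE /= => uv.
    apply: le_trans (l2_psum_le (v - u) A) _.
    by rewrite l2_ip_norm distrC ler_pXn2r ?nnegrE // ?ltW.
  rewrite /psum; elim: (enum_fset A) => [|x s ih].
    by under eq_fun do rewrite big_nil; rewrite big_nil; exact: cvg_cst.
  under eq_fun do rewrite big_cons; rewrite big_cons; apply: cvgD ih.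
  under eq_fun do rewrite normCK; rewrite normCK.
  have h : (fun v : l2 => v x - u x : C^o) @ F --> (L x - u x : C^o).
    exact: cvgB (FL x) (cvg_cst _).
  exact: cvgM h (cvg_conjC FF h).
have dP u e : 0 < e -> F (ball u e) ->
    (L : E -> C^o) - l2fun u \in square_summable.
  move=> e0 Fu; apply/asboolP; exists (e ^+ 2) => A; exact: near_le.
have LP : L \in square_summable.
  have [u Fu] := Fc 1 ltr01; rewrite -(subrK (l2fun u) L).
  by apply: rpredD; [exact: dP Fu|exact: l2funP].
apply/cvg_ex; exists (L2 LP); apply/cvgrPdist_lt => /= e e0.
have e2 : 0 < e / 2 by rewrite divr_gt0.
have [u Fu] := Fc (e / 2) e2.
apply: filterS (Fu) => v; rewrite -ball_normE /= => uv.
rewrite -(subrK u (L2 LP)) -addrA [e]splitr.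
apply: le_lt_trans (ler_normD _ _) _; apply: ler_ltD => //.
rewrite -(ler_pXn2r (n := 2)) ?nnegrE ?(ltW e2) // -l2_ip_norm.
by apply: l2_ip_le => A; exact: near_le.
Qed.

HB.instance Definition _ := Uniform_isComplete.Build l2 l2_complete.

HB.instance Definition _ := isHilbert.Build R l2
  l2_ipDl l2_ipZl l2_ipC l2_ip_norm.

End SquareSummable.

(** * Continuity of *-homomorphisms *)

Section ClosedSets.
Variables (K : numFieldType) (V : normedModType K).

Lemma closedP (A : set V) :
  closed A <-> forall x, (forall e, 0 < e -> exists2 y, A y & `|x - y| < e) -> A x.
Proof.
split=> [cA x xA|cA x xA].
  apply: cA => U /nbhs_ballP[e /= e0 eU]; have [y Ay xy] := xA e e0.
  by exists y; split=> //; apply: eU; rewrite -ball_normE.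
apply: cA => e e0; have [y [Ay]] := xA _ (nbhsx_ballx x e e0).
by rewrite -ball_normE; exists y.
Qed.

Lemma norm_le_eps_eq0 (x : V) (k : K) : 0 <= k ->
  (forall e, 0 < e -> `|x| <= k * e) -> x = 0.
Proof.
move=> k0 xk; apply/eqP; rewrite -normr_le0; apply/ler_addgt0Pr => e e0.
have k1 : 0 < k + 1 by rewrite ltr_wpDl.
apply: le_trans (xk (e / (k + 1)) _) _; first by rewrite divr_gt0.
by rewrite add0r mulrCA ger_pMr // ler_pdivrMr // mul1r lerDl.
Qed.

End ClosedSets.

Section CstarAlgebra.
Variables (R : realType) (B : cstarType R).
Local Notation C := (R[i]%C).
Implicit Types a b c : B.

Lemma cmulNl a b : (- a) ** b = - (a ** b).
Proof. by rewrite -scaleN1r cmulZl scaleN1r. Qed.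

Lemma cmulNr a b : a ** (- b) = - (a ** b).
Proof. by rewrite -scaleN1r cmulZr scaleN1r. Qed.

Lemma cmulBl a b c : (a - b) ** c = a ** c - b ** c.
Proof. by rewrite cmulDl cmulNl. Qed.

Lemma cmulBr a b c : c ** (a - b) = c ** a - c ** b.
Proof. by rewrite cmulDr cmulNr. Qed.

Lemma starN a : star (- a) = - star a.
Proof. by rewrite -scaleN1r starZ conjCN1 scaleN1r. Qed.

Lemma starB a b : star (a - b) = star a - star b.
Proof. by rewrite starD starN. Qed.

Lemma cmul_suml (I : Type) (r : seq I) (F : I -> B) a :
  a ** (\sum_(i <- r) F i) = \sum_(i <- r) a ** F i.
Proof.
by elim: r => [|i r ih]; rewrite ?(big_nil, big_cons) ?cmul0r // cmulDr ih.
Qed.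

Lemma cmulMn a b n : (a *+ n) ** b = (a ** b) *+ n.
Proof. by elim: n => [|n ih]; rewrite ?mulr0n ?cmul0l // !mulrS cmulDl ih. Qed.

Lemma cmulrMn a b n : a ** (b *+ n) = (a ** b) *+ n.
Proof. by elim: n => [|n ih]; rewrite ?mulr0n ?cmul0r // !mulrS cmulDr ih. Qed.

Lemma cnorm_projection (p : B) : is_projection p -> `|p| <= 1.
Proof.
move=> [pp ps]; have [->|p0] := eqVneq p 0; first by rewrite normr0.
by rewrite -(ler_pM2r (x := `|p|)) ?normr_gt0 // -expr2 -cstar_identity ps pp mul1r.
Qed.

Lemma small_projection_eq0 (p : B) : is_projection p -> `|p| < 1 -> p = 0.
Proof.
move=> [pp ps]; have [//|p0] := eqVneq p 0.
suff -> : `|p| = 1 by rewrite ltxx.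
apply: (mulIf (_ : `|p| != 0)); first by rewrite normr_eq0.
by rewrite mul1r -expr2 -cstar_identity ps pp.
Qed.

Lemma is_unit_unique (e e' : B) : is_unit e -> is_unit e' -> e = e'.
Proof. by move=> ue ue'; rewrite -(proj1 (ue' e)) (proj2 (ue e')). Qed.

Lemma unit_compl_mul (e a b : B) : is_unit e ->
  e - (e - a) ** (e - b) = a + b - a ** b.
Proof.
move=> ue; rewrite cmulBl (proj1 (ue _)) cmulBr (proj2 (ue _)).
by rewrite -[_ - _ - (_ - _)]addrA -opprD subKr addrCA addrA.
Qed.

Lemma star_unit (e : B) : is_unit e -> star e = e.
Proof.
by move=> ue; rewrite -(proj1 (ue (star e))) -{1}(starK e) -starM (proj1 (ue _)) starK.
Qed.

Lemma cstar_gen_subalgebra (S : set B) : is_cstar_subalgebra (cstar_gen S).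
Proof.
split; first split.
- by move=> V [[[? _ _ _ _] _] _].
- by move=> a b aS bS V VS; case: (VS) => [[[_ h _ _ _] _] _]; apply: h; [apply: aS|apply: bS].
- by move=> k a aS V VS; case: (VS) => [[[_ _ h _ _] _] _]; apply: h; apply: aS.
- by move=> a b aS bS V VS; case: (VS) => [[[_ _ _ h _] _] _]; apply: h; [apply: aS|apply: bS].
- by move=> a aS V VS; case: (VS) => [[[_ _ _ _ h] _] _]; apply: h; apply: aS.
by apply: closed_bigI => V [[_ ?] _].
Qed.

Lemma cstar_gen_incl (S : set B) : S `<=` cstar_gen S.
Proof. exact: sub_gen_smallest. Qed.

Lemma cstar_gen_min (S V : set B) :
  is_cstar_subalgebra V -> S `<=` V -> cstar_gen S `<=` V.
Proof. by move=> VA SV; apply: smallest_sub. Qed.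

Lemma subalgebraB (V : set B) a b :
  is_cstar_subalgebra V -> V a -> V b -> V (a - b).
Proof. by move=> [[_ VD VZ _ _] _] Va Vb; rewrite -scaleN1r; apply/VD/VZ. Qed.

(* y = 1 - sqrt (1 - h^2) is the fixed point of y |-> (h^2 + y^2) / 2, which
   contracts the ball of radius 1/2. *)
Lemma sqrt_one_minus_sqr (h : B) : star h = h -> `|h| <= 2^-1 ->
  exists y, [/\ star y = y, y ** h = h ** y & h ** h + y ** y = y *+ 2].
Proof.
move=> hs h2; pose f y := 2^-1 *: (h ** h + y ** y); 
have [y [y0 yS]] : exists y : nat -> B, y 0%N = 0 /\ forall n, y n.+1 = f (y n).
  by exists (fun n => iter n f 0).
have half0 : 0 <= 2^-1 :> C by rewrite invr_ge0.
have half2 : 2^-1 + 2^-1 = 1 :> C by rewrite [RHS]splitr !mul1r.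
have halfX k : 2^-1 ^+ k = 2^-1 ^+ k.+1 + 2^-1 ^+ k.+1 :> C.
  by rewrite exprS -mulrDl half2 mul1r.
have fE a : f a *+ 2 = h ** h + a ** a.
  by rewrite /f -scaler_nat scalerA divff ?pnatr_eq0 // scale1r.
have y2 n : `|y n| <= 2^-1.
  elim: n => [|n ih]; first by rewrite y0 normr0.
  rewrite yS /f normrZ ger0_norm // -[leRHS]mulr1 ler_wpM2l //.
  rewrite (le_trans (ler_normD _ _)) // -half2 lerD //.
    rewrite (le_trans (cnormM _ _)) // -[leRHS]mulr1 ler_pM // (le_trans h2) //.
    by rewrite invf_le1 ?ler1n.
  rewrite (le_trans (cnormM _ _)) // -[leRHS]mulr1 ler_pM // (le_trans ih) //.
  by rewrite invf_le1 ?ler1n.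
have fB a b : `|f a - f b| <= 2^-1 * ((`|a| + `|b|) * `|a - b|).
  rewrite /f -scalerBr normrZ ger0_norm // ler_wpM2l // opprD addrACA subrr add0r.
  have -> : a ** a - b ** b = a ** (a - b) + (a - b) ** b.
    by rewrite cmulBr cmulBl addrA subrK.
  rewrite (le_trans (ler_normD _ _)) // mulrDl lerD ?cnormM //.
  by rewrite mulrC cnormM.
have dy n : `|y n.+1 - y n| <= 2^-1 ^+ n.+1.
  elim: n => [|n ih]; first by rewrite y0 subr0 expr1.
  rewrite 2!yS (le_trans (fB _ _)) // -!yS exprS ler_wpM2l // (le_trans _ ih) //.
  by rewrite ler_piMl // -half2 lerD.
have yN m n : `|y (m + n)%N - y m| <= 2^-1 ^+ m.
  (* Strengthened for the induction: the difference is the exact sum of the bounds 2^-(k+1) for k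
     from m to m + n - 1. *)
  suff : `|y (m + n)%N - y m| <= 2^-1 ^+ m - 2^-1 ^+ (m + n)%N.
    by move=> /le_trans; apply; rewrite lerBlDr lerDl exprn_ge0.
  elim: n => [|n ih]; first by rewrite addn0 !subrr normr0.
  rewrite addnS -(subrK (y (m + n)%N) (y (m + n).+1)) -addrA.
  rewrite (le_trans (ler_normD _ _)) // (le_trans (lerD (dy _) ih)) //.
  rewrite addrCA lerD2l (halfX (m + n)%N).
  by rewrite opprD addrA subrr add0r.
have small e : 0 < e :> C -> exists n, 2^-1 ^+ n < e.
  move=> e0; have eE := ReK (ltW e0).
  have d0 : 0 < complex.Re e by rewrite -ltcR eE.
  have [N _ /(_ N (leqnn _))] := near_infty_natSinv_expn_lt (PosNum d0).
  rewrite /= -ltcR eE => h1; exists N; apply: le_lt_trans h1.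
  by rewrite exprVn div1r rmorphV ?unitfE ?expf_neq0 ?pnatr_eq0 // rmorphXn /= rmorph_nat.
have [l yl] : exists l : B, y @ \oo --> l.
  apply/cvg_ex; apply: cauchy_cvg; apply/cauchyP => e e0.
  have [N Ne] := small e e0; exists (y N); exists N => // n /= Nn.
  rewrite -ball_normE /= -(subnKC Nn) distrC.
  exact: le_lt_trans (yN _ _) Ne.
have near_l e : 0 < e -> exists n, `|l - y n| < e /\ `|l - y n.+1| < e.
  move=> e0; move/cvgrPdist_lt: yl => /(_ e e0) [N _ NP].
  by exists N; split; apply: NP => /=.
(* The iterates are polynomials in h, hence self-adjoint and commuting with h; both properties pass
   to the limit. *)
have ys n : star (y n) = y n.
  elim: n => [|n ih]; first by rewrite y0 star0.
  by rewrite yS /f starZ starD !starM ih hs fmorphV rmorph_nat.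
have yh n : y n ** h = h ** y n.
  elim: n => [|n ih]; first by rewrite y0 cmul0l cmul0r.
  rewrite yS /f cmulZl cmulZr cmulDl cmulDr -!cmulA; congr (_ *: (_ + _)).
  by rewrite ih cmulA ih cmulA.
exists l; split.
- apply/subr0_eq/(norm_le_eps_eq0 (k := 2)) => // e e0; have [n [ln _]] := near_l e e0.
  rewrite -(subrK (y n) (star l)) -{1}(ys n) -starB -addrA mulrDl !mul1r.
  by rewrite (le_trans (ler_normD _ _)) // cnorm_star [X in _ + X]distrC lerD ?ltW.
- apply/subr0_eq/(norm_le_eps_eq0 (k := `|h| + `|h|)) => [|e e0]; first by rewrite addr_ge0.
  have [n [ln _]] := near_l e e0.
  rewrite -(subrK (y n ** h) (l ** h)) {2}yh -addrA -cmulBl -cmulBr.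
  rewrite (le_trans (ler_normD _ _)) // mulrDl lerD // (le_trans (cnormM _ _)) //.
    by rewrite mulrC ler_wpM2l // ltW.
  by rewrite distrC ler_wpM2l // ltW.
- rewrite -fE; congr (_ *+ 2); apply/esym/subr0_eq.
  have k0 : 0 <= 1 + 2^-1 * (`|l| + 2^-1) by rewrite addr_ge0 ?mulr_ge0 ?addr_ge0.
  apply: (norm_le_eps_eq0 k0) => e e0; have [n [ln lSn]] := near_l e e0.
  rewrite -[l - f l](subrKA (y n.+1)) mulrDl mul1r (le_trans (ler_normD _ _)) //.
  rewrite lerD ?(ltW lSn) // yS (le_trans (fB _ _)) // -mulrA ler_wpM2l //.
  by rewrite addrC distrC ler_pM ?addr_ge0 ?lerD ?(ltW ln).
Qed.
End CstarAlgebra.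

Section StarHom.
Variables (R : realType) (B B' : cstarType R).
Local Notation C := (R[i]%C).
Variable f : B -> B'.
Hypothesis fH : is_star_hom f.

Lemma homD a b : f (a + b) = f a + f b. Proof. by case: fH. Qed.
Lemma homZ (k : C) a : f (k *: a) = k *: f a. Proof. by case: fH. Qed.
Lemma homM a b : f (a ** b) = f a ** f b. Proof. by case: fH. Qed.
Lemma hom_star a : f (star a) = star (f a). Proof. by case: fH. Qed.

Lemma hom0 : f 0 = 0. Proof. by rewrite -(scale0r (0 : B)) homZ scale0r. Qed.

Lemma homN a : f (- a) = - f a.
Proof. by rewrite -scaleN1r homZ scaleN1r. Qed.

Lemma homB a b : f (a - b) = f a - f b.
Proof. by rewrite homD homN. Qed.

Lemma homMn a n : f (a *+ n) = f a *+ n.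
Proof. by elim: n => [|n ih]; rewrite ?mulr0n ?hom0 // !mulrS homD ih. Qed.

Lemma hom_sum (I : Type) (r : seq I) (F : I -> B) :
  f (\sum_(i <- r) F i) = \sum_(i <- r) f (F i).
Proof.
by elim: r => [|i r ih]; rewrite ?(big_nil, big_cons) ?hom0 // homD ih.
Qed.

(* With h^2 + (1 - y)^2 = 1, the element h + i (1 - y) is unitary; the unit
   is avoided by working with z = f h - i f y instead. *)
Lemma hom_bound_small h : star h = h -> `|h| <= 2^-1 -> `|f h| <= 2.
Proof.
move=> hs h2; have [y [ys yh hy]] := sqrt_one_minus_sqr hs h2.
pose z := f h - 'i *: f y; have sz : star z = f h + 'i *: f y.
  by rewrite starB starZ conjCi -!hom_star hs ys scaleNr opprK.
(* The cross terms cancel because y commutes with h. With [zs] this closes up: |z|^2 = |2 f y| =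
   |star z - z| <= 2|z|, so |z| <= 2 although no bound on [f y] is known beforehand. *)
have zz : star z ** z = f y *+ 2.
  rewrite sz cmulDl !cmulBr !(cmulZl, cmulZr) scalerA -expr2 sqrCi scaleN1r opprK.
  by rewrite -!homM yh addrA subrK -homD hy homMn.
have zs : (2 * 'i) *: f y = star z - z.
  by rewrite sz opprB addrC addrA subrK -scalerDl -mulr2n mulr_natl.
have n2 : `|f y *+ 2| <= 2 * `|z|.
  have -> : `|f y *+ 2| = `|(2 * 'i) *: f y|.
    by rewrite normrZ normrM normCi mulr1 normr_nat -scaler_nat normrZ normr_nat.
  by rewrite zs (le_trans (ler_normB _ _)) // cnorm_star mulr_natl mulr2n.
have z2 : `|z| <= 2.
  have [->|z0] := eqVneq z 0; first by rewrite normr0.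
  by rewrite -(ler_pM2r (x := `|z|)) ?normr_gt0 // -expr2 -cstar_identity zz.
have -> : f h = 2^-1 *: (star z + z).
  by rewrite sz addrACA addrN addr0 -mulr2n -[f h *+ 2]scaler_nat scalerA mulVf ?scale1r.
rewrite normrZ normfV normr_nat mulrC ler_pdivrMr // (le_trans (ler_normD _ _)) //.
by rewrite cnorm_star mulr_natr mulr2n lerD.
Qed.

(** Rescaling a self-adjoint element to norm 1/2 gives the constant 4 for such elements; applied to
    [star a ** a], the C*-identity turns it into its square root 2. Contractivity would need
    spectral theory, but any constant yields continuity. *)
Lemma hom_bound a : `|f a| <= 2 * `|a|.
Proof.
have sa h : star h = h -> `|f h| <= 4 * `|h|.
  move=> hs; have [->|h0] := eqVneq h 0; first by rewrite hom0 !normr0 mulr0.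
  have n0 : 0 < `|h| by rewrite normr_gt0.
  have n2 : 0 < 2 * `|h| by rewrite mulr_gt0.
  have := @hom_bound_small ((2 * `|h|)^-1 *: h).
  rewrite starZ geC0_conj ?invr_ge0 ?(ltW n2) // hs homZ !normrZ normfV.
  rewrite (ger0_norm (ltW n2)) invfM -mulrA mulVf ?normr_eq0 // mulr1.
  move=> /(_ erefl (lexx _)); rewrite -invfM mulrC ler_pdivrMr // mulrA.
  by rewrite -natrM.
rewrite -(ler_pXn2r (n := 2)) ?nnegrE ?mulr_ge0 // -cstar_identity.
rewrite -hom_star -homM (le_trans (sa _ _)) //; first by rewrite starM starK.
by rewrite cstar_identity exprMn -natrX.
Qed.

Lemma hom_preimage_subalgebra (V : set B') :
  is_cstar_subalgebra V -> is_cstar_subalgebra (f @^-1` V).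
Proof.
move=> [[V0 VD VZ VM VS] cV]; split; first split.
- by rewrite /= hom0.
- by move=> a b /= Va Vb; rewrite homD; apply: VD.
- by move=> k a /= Va; rewrite homZ; apply: VZ.
- by move=> a b /= Va Vb; rewrite homM; apply: VM.
- by move=> a /= Va; rewrite hom_star; apply: VS.
apply/closedP => a ha /=; move/closedP: cV; apply => e e0.
have [|b Vb ab] := ha (e / 2); first by rewrite divr_gt0.
exists (f b) => //; rewrite -homB (le_lt_trans (hom_bound _)) //.
by rewrite mulrC -ltr_pdivlMr.
Qed.

End StarHom.

Lemma hom_ext (R : realType) (B B' : cstarType R) (f g : B -> B') (S : set B) :
  is_star_hom f -> is_star_hom g -> cstar_gen S = setT ->
  (forall a, S a -> f a = g a) -> forall a, f a = g a.
Proof.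
move=> fH gH ST fg a; suff : cstar_gen S `<=` [set a | f a = g a].
  by rewrite ST; apply.
apply: cstar_gen_min => //; split; first split.
- by rewrite /= (hom0 fH) (hom0 gH).
- by move=> b c /= eb ec; rewrite (homD fH) (homD gH) eb ec.
- by move=> k b /= eb; rewrite (homZ fH) (homZ gH) eb.
- by move=> b c /= eb ec; rewrite (homM fH) (homM gH) eb ec.
- by move=> b /= eb; rewrite (hom_star fH) (hom_star gH) eb.
apply/closedP => b hb /=; apply/subr0_eq/(norm_le_eps_eq0 (k := 4)) => // e e0.
have [c /= ec bc] := hb e e0.
rewrite -(subrK (f c) (f b)) -addrA {2}ec -(homB fH) -(homB gH).
rewrite (le_trans (ler_normD _ _)) // (_ : 4 * e = 2 * e + 2 * e); last first.
  by rewrite -mulrDl -natrD.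
apply: lerD; first by rewrite (le_trans (hom_bound fH _)) // ler_wpM2l // ltW.
by rewrite (le_trans (hom_bound gH _)) // ler_wpM2l // distrC ltW.
Qed.

Lemma comp_star_hom (R : realType) (B1 B2 B3 : cstarType R)
    (f : B2 -> B3) (g : B1 -> B2) :
  is_star_hom f -> is_star_hom g -> is_star_hom (fun a => f (g a)).
Proof.
move=> fH gH; split=> *.
- by rewrite (homD gH) (homD fH).
- by rewrite (homZ gH) (homZ fH).
- by rewrite (homM gH) (homM fH).
- by rewrite (hom_star gH) (hom_star fH).
Qed.

Lemma id_star_hom (R : realType) (B : cstarType R) : is_star_hom (@id B).
Proof. by []. Qed.

(** * Cylinder sets and their projections *)

Section Cylinders.
Variables (I : choiceType) (A : I -> I -> bool).

(* Boolean expressions in the cylinder sets of the Markov chain: [CQ b] stands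
   for the domain of b^-1 and [CCons a t] for the points a x with x in [t]. *)
Inductive cylinder :=
  | CTop
  | CQ of I
  | CAnd of cylinder & cylinder
  | CNot of cylinder
  | CCons of I & cylinder.

Fixpoint csem t (x : nat -> I) : bool :=
  match t with
  | CTop => true
  | CQ b => A b (x 0%N)
  | CAnd t1 t2 => csem t1 x && csem t2 x
  | CNot t => ~~ csem t x
  | CCons a t => (x 0%N == a) && csem t (shift_seq x)
  end.

Definition cset t : set (nat -> I) := [set x | markov_chain A x /\ csem t x].

(* The points x for which a x belongs to [t], up to the condition A a (x 0). *)
Fixpoint cshift a t :=
  match t with
  | CTop => CTop
  | CQ b => if A b a then CTop else CNot CTop
  | CAnd t1 t2 => CAnd (cshift a t1) (cshift a t2)
  | CNot t => CNot (cshift a t)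
  | CCons c t => if c == a then t else CNot CTop
  end.

Fixpoint cdepth t :=
  match t with
  | CTop | CQ _ => 0%N
  | CAnd t1 t2 => maxn (cdepth t1) (cdepth t2)
  | CNot t => cdepth t
  | CCons _ t => (cdepth t).+1
  end.

(** Only the outermost [CCons] are recorded, and [cletters] likewise stops at them: at a point whose
    first letter is not a head, every [CCons] is false whatever stands below it. *)
Fixpoint cheads t : seq I :=
  match t with
  | CTop | CQ _ => [::]
  | CAnd t1 t2 => cheads t1 ++ cheads t2
  | CNot t => cheads t
  | CCons a _ => [:: a]
  end.

Fixpoint cletters t : seq I :=
  match t with
  | CTop | CCons _ _ => [::]
  | CQ b => [:: b]
  | CAnd t1 t2 => cletters t1 ++ cletters t2
  | CNot t => cletters t
  end.

(* The truth value of [t] at the points x whose first letter is not in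
   [cheads t] and which satisfy A b (x 0) = b \in X for b in [cletters t]. *)
Fixpoint cval (X : {fset I}) t :=
  match t with
  | CTop => true
  | CQ b => b \in X
  | CAnd t1 t2 => cval X t1 && cval X t2
  | CNot t => ~~ cval X t
  | CCons _ _ => false
  end.

Fixpoint word_cylinder (w : seq (letter I)) :=
  match w with
  | [::] => CTop
  | l :: w => if l.2 then CAnd (CQ l.1) (cshift l.1 (word_cylinder w))
              else CCons l.1 (word_cylinder w)
  end.

Lemma csetI t t' : cset t `&` cset t' = cset (CAnd t t').
Proof.
apply/seteqP; split=> [x [[xX xt] [_ xt']]|x [xX /andP[]]//].
by split=> //=; rewrite xt.
Qed.

Lemma csetC t : markov_chain A `\` cset t = cset (CNot t).
Proof.
apply/seteqP; split=> [x [xX xt]|x [xX /= /negP xt]]; last by split=> // -[].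
by split=> //=; apply/negP => ?; apply: xt.
Qed.

Lemma csetU t t' : cset t `|` cset t' = cset (CNot (CAnd (CNot t) (CNot t'))).
Proof.
apply/seteqP; split=> [x [[xX xt]|[xX xt]]|x [xX]] /=.
- by split=> //=; rewrite xt.
- by split=> //=; rewrite xt andbF.
- by rewrite negb_and !negbK => /orP[]; [left|right].
Qed.

Lemma csem_cshift a t x : x 0%N = a -> csem t x = csem (cshift a t) (shift_seq x).
Proof.
move=> xa; elim: t => //= [b|t1 -> t2 ->|t ->|c t _] //.
  by rewrite xa; case: (A b a).
by rewrite xa eq_sym; case: (c == a).
Qed.

Lemma cdepth_cshift a t : (cdepth (cshift a t) <= (cdepth t).-1)%N.
Proof.
elim: t => //= [b|t1 h1 t2 h2|c t _]; [by case: (A b a)| |by case: (c == a)].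
rewrite geq_max (leq_trans h1) ?(leq_trans h2) //.
  by rewrite -!subn1 leq_sub2r // leq_maxr.
by rewrite -!subn1 leq_sub2r // leq_maxl.
Qed.

Lemma cheads_depth a t : a \in cheads t -> (0 < cdepth t)%N.
Proof.
elim: t => //= t1 h1 t2 h2; rewrite mem_cat leq_max => /orP[/h1 ->//|/h2 ->].
by rewrite orbT.
Qed.

Lemma csem_cval (X : {fset I}) t x :
  (forall b, b \in cletters t -> A b (x 0%N) = (b \in X)) ->
  x 0%N \notin cheads t -> csem t x = cval X t.
Proof.
elim: t => //= [b|t1 h1 t2 h2|t h|a t _].
- by move=> /(_ b); rewrite inE eqxx => ->.
- move=> bX; rewrite mem_cat negb_or => /andP[x1 x2].
  by rewrite h1 ?h2 // => b bt; apply: bX; rewrite mem_cat bt ?orbT.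
- by move=> bX xt; rewrite h.
- by rewrite inE => _ /negPf ->.
Qed.

Lemma letter_domE l x :
  letter_dom A l x <-> if l.2 then markov_chain A x /\ A l.1 (x 0%N)
                       else markov_chain A x /\ x 0%N = l.1.
Proof.
case: l => a [] //=; split.
  rewrite /letter_dom /= => -[y [yX y0] <-]; split=> [k|]; first exact: yX.
  by rewrite -y0; exact: yX.
move=> [xX xa]; exists (cons_seq a x); last by apply/funext.
by split=> // -[|k] //=; exact: xX.
Qed.

Lemma word_dom_cylinder w : word_dom A w = cset (word_cylinder w).
Proof.
elim: w => [|[a []] w ih] /=; first by apply/seteqP; split=> [x|x []].
- apply/seteqP; split=> y /=.
    move=> [x [+ /letter_domE /= [xX xa]] <-]; rewrite ih => -[_ xw].
    split=> [k|/=]; first exact: xX.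
    by rewrite /letter_act /= -(csem_cshift _ xa) xw andbT -xa; exact: xX.
  move=> [yX /andP[ya yw]]; have cX : markov_chain A (cons_seq a y).
    by case=> [|k] //=; exact: yX.
  exists (cons_seq a y); last by apply/funext.
  split; last by apply/letter_domE.
  by rewrite ih; split=> //; rewrite (csem_cshift (a := a)).
- apply/seteqP; split=> y /=.
    move=> [x [+ /letter_domE /= [xX xa]] <-]; rewrite ih => -[_ xw].
    split; last by rewrite /= eqxx.
    by case=> [|k] //=; exact: xX.
  move=> [yX /andP[/eqP ya yw]]; exists (shift_seq y); last first.
    by apply/funext => -[|n] //=; rewrite /letter_act /= ya.
  have sX : markov_chain A (shift_seq y) by move=> k; exact: yX.
  split; first by rewrite ih.
  by apply/letter_domE; split => //=; rewrite -ya; exact: yX.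
Qed.

Lemma cset_shift_empty a t : cset t = set0 ->
  cset (CAnd (CQ a) (cshift a t)) = set0.
Proof.
move=> t0; rewrite -subset0 => x [xX /andP[/= ax xt]].
suff : cset t (cons_seq a x) by rewrite t0.
split; last by rewrite (csem_cshift (a := a)).
by case=> [|k] //=; exact: xX.
Qed.

Lemma markov_chain_start : (forall i, exists j, A i j) ->
  forall j, exists2 x, markov_chain A x & x 0%N = j.
Proof.
move=> /choice[f fA] j; exists (fun n => iter n f j) => // k; exact: fA.
Qed.

End Cylinders.

Arguments CTop {I}.

(* The relations defining O_A with 1 interpreted as the unit [u] of an ambient
   unital algebra. *)
Record unital_EL (R : realType) (I : choiceType) (A : I -> I -> bool)
    (U : cstarType R) (u : U) (S : I -> U) : Prop := {
  EL_unit : is_unit u;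
  EL_isom : forall i, is_partial_isometry (S i);
  EL_sum : EL_relation1 A u S;
  EL_comm : forall i j, (star (S i) ** S i) ** (star (S j) ** S j) =
                        (star (S j) ** S j) ** (star (S i) ** S i);
  EL_orth : forall i j, i <> j -> star (S i) ** S j = 0;
  EL_shift : forall i j, star (S i) ** S i ** S j = S j *+ A i j
}.

(** * From an Exel-Laca family to the relations of the system *)

Section FromExelLaca.
Variables (R : realType) (I : choiceType) (A : I -> I -> bool).
Hypothesis A_no_zero_row : forall i, exists j, A i j.
Variables (U : cstarType R) (u : U) (S : I -> U).
Hypothesis SE : unital_EL A u S.

Let u_l a : u ** a = a. Proof. by case: (EL_unit SE a). Qed.
Let u_r a : a ** u = a. Proof. by case: (EL_unit SE a). Qed.
Let star_u : star u = u. Proof. exact: star_unit (EL_unit SE). Qed.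

Let Q i := star (S i) ** S i.

Let SQ i : S i ** Q i = S i. Proof. by rewrite cmulA (EL_isom SE). Qed.
Let star_Q i : star (Q i) = Q i. Proof. by rewrite starM starK. Qed.
Let QsS i : Q i ** star (S i) = star (S i).
Proof. by rewrite -[RHS](congr1 star (SQ i)) starM star_Q. Qed.
Let QQ i : Q i ** Q i = Q i. Proof. by rewrite {2}/Q cmulA QsS. Qed.
Let QS b a : Q b ** S a = S a *+ A b a. Proof. exact: (EL_shift SE). Qed.
Let QC a b : Q a ** Q b = Q b ** Q a. Proof. exact: (EL_comm SE). Qed.
Let sSQ b a : star (S a) ** Q b = star (S a) *+ A b a.
Proof.
rewrite -{1}star_Q -starM QS; case: (A b a); rewrite ?mulr1n //.
by rewrite !mulr0n star0.
Qed.

(** Defined on expressions rather than on sets; independence of the expression is [cproj_cset],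
    which rests on relation (1). *)
Fixpoint cproj t : U :=
  match t with
  | CTop => u
  | CQ b => Q b
  | CAnd t1 t2 => cproj t1 ** cproj t2
  | CNot t => u - cproj t
  | CCons a t => S a ** cproj t ** star (S a)
  end.

Let comm (a b : U) := a ** b = b ** a.

Let comm_u a : comm a u. Proof. by rewrite /comm u_l u_r. Qed.

Let comm_mul a b c : comm a b -> comm a c -> comm a (b ** c).
Proof. by move=> ab ac; rewrite /comm cmulA ab -cmulA ac cmulA. Qed.

Let comm_not a b : comm a b -> comm a (u - b).
Proof. by move=> ab; rewrite /comm cmulBl cmulBr ab u_l u_r. Qed.

Let comm_sym a b : comm a b -> comm b a. Proof. by []. Qed.

Let cproj_commQ b t : comm (Q b) (cproj t).
Proof.
elim: t => [|c|t1 h1 t2 h2|t h|a t _] /=.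
- exact: comm_u.
- exact: QC.
- exact: comm_mul.
- exact: comm_not.
rewrite /comm !cmulA QS -!cmulA sSQ; case: (A b a); rewrite ?mulr1n ?cmulA //.
by rewrite !mulr0n !cmul0r !cmul0l.
Qed.

(** The essential case is that of two prefixes: equal letters reduce to the expressions below them,
    and distinct letters give 0 on both sides because the ranges are orthogonal. *)
Lemma cproj_comm t1 t2 : cproj t1 ** cproj t2 = cproj t2 ** cproj t1.
Proof.
rewrite -/(comm _ _).
elim: t1 t2 => [|b|t h t' h'|t h|a t h] t2 /=.
- exact/comm_sym/comm_u.
- exact: cproj_commQ.
- by apply/comm_sym/comm_mul; apply/comm_sym.
- exact/comm_sym/comm_not/comm_sym.
elim: t2 => [|b|t1 h1 t2 h2|t1 h1|c t1 h1] /=.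
- exact: comm_u.
- by apply/comm_sym; exact: (cproj_commQ b (CCons a t)).
- exact: comm_mul.
- exact: comm_not.
rewrite /comm; have [<-|ac] := eqVneq a c.
  have e t3 t4 : S a ** cproj t3 ** star (S a) ** (S a ** cproj t4 ** star (S a)) =
      S a ** (cproj t3 ** cproj t4) ** star (S a).
    rewrite -!cmulA [star _ ** (_ ** _)]cmulA -/(Q a) [Q a ** _]cmulA.
    rewrite (cproj_commQ a t4) -[cproj t4 ** Q a ** _]cmulA QsS.
    by [].
  by rewrite !e h.
have e b b' t3 t4 : b <> b' ->
    S b ** cproj t3 ** star (S b) ** (S b' ** cproj t4 ** star (S b')) = 0.
  move=> bb; rewrite -!cmulA [star _ ** (_ ** _)]cmulA (EL_orth SE bb).
  by rewrite cmul0l !cmul0r.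
by rewrite !e //; apply/eqP => //; rewrite eq_sym.
Qed.

Lemma cprojP t : is_projection (cproj t).
Proof.
elim: t => [|b|t [ti ts] t' [ti' ts']|t [ti ts]|a t [ti ts]]; split=> //=.
- rewrite -cmulA [cproj t' ** _]cmulA (cproj_comm t') -cmulA ti' cmulA ti.
  by [].
- by rewrite starM ts ts' cproj_comm.
- by rewrite cmulBr u_r cmulBl u_l ti subrr subr0.
- by rewrite starB ts star_u.
- rewrite -!cmulA [star _ ** (_ ** _)]cmulA -/(Q a) [Q a ** _]cmulA.
  by rewrite (cproj_commQ a t) -[cproj t ** Q a ** _]cmulA QsS !cmulA -(cmulA (S a)) ti.
- by rewrite !starM starK ts cmulA.
Qed.

(** The operator counterpart of [csem_cshift]: moving S_a to the left strips a letter off the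
    expression, which makes the depth drop in [cproj_empty]. *)
Lemma cproj_cshift a t : cproj t ** S a = S a ** cproj (cshift A a t).
Proof.
elim: t => [|b|t1 h1 t2 h2|t h|c t _] /=.
- by rewrite u_l u_r.
- rewrite QS; case: (A b a) => /=; first by rewrite mulr1n u_r.
  by rewrite subrr cmul0r.
- by rewrite -cmulA h2 cmulA h1 cmulA.
- by rewrite cmulBl cmulBr h u_l u_r.
have [->|ca] := eqVneq c a.
  by rewrite -!cmulA -/(Q a) -(cproj_commQ a t) cmulA SQ.
rewrite -cmulA (EL_orth SE (elimN eqP ca)) /= subrr !cmul0r.
by [].
Qed.

(** The operator counterpart of [csem_cval]. The element [c] plays the role of an atom, on which
    each letter has a definite truth value and every prefix is false. *)
Lemma cval_cproj (X : {fset I}) c t :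
  (forall b, b \in cletters t -> c ** Q b = c *+ (b \in X)) ->
  (forall a, a \in cheads t -> c ** S a = 0) ->
  c ** cproj t = c *+ cval X t.
Proof.
elim: t => [|b|t1 h1 t2 h2|t h|a t _] /= hQ hS.
- by rewrite u_r.
- by rewrite hQ // inE.
- rewrite cmulA h1; [|move=> b bt; apply: hQ|move=> b bt; apply: hS];
    rewrite ?mem_cat ?bt //.
  rewrite cmulMn h2; [|move=> b bt; apply: hQ|move=> b bt; apply: hS];
    rewrite ?mem_cat ?bt ?orbT //.
  by case: (cval X t1); case: (cval X t2).
- by rewrite cmulBr u_r h //; case: (cval X t); rewrite /= ?subrr ?subr0.
- by rewrite !cmulA hS ?inE // !cmul0l.
Qed.

Lemma Aprod_neq0 (X Y : {fset I}) j : Aprod A X Y j != 0%N ->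
  (forall x, x \in X -> A x j) /\ (forall y, y \in Y -> ~~ A y j).
Proof.
rewrite /Aprod muln_eq0 negb_or => /andP[hX hY]; split=> [x xX|y yY].
  by apply: contraR hX => /negPf Ax; rewrite (big_fsetD1 x xX) /= Ax mul0n.
by apply: contra hY => Ay; rewrite (big_fsetD1 y yY) /= Ay subnn mul0n.
Qed.

Lemma big_cmul_fix (c : U) (F : I -> U) r :
  (forall i, i \in r -> c ** F i = c) -> c ** \big[@cmul R U/u]_(i <- r) F i = c.
Proof.
elim: r => [|i r ih] h; first by rewrite big_nil u_r.
by rewrite big_cons cmulA h ?inE ?eqxx // ih // => j jr; rewrite h // inE jr orbT.
Qed.

(* An atom of the Boolean algebra generated by the letters of an empty
   cylinder either lies outside the cylinder or meets finitely many sets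
   a X,
   with a a head of the cylinder; in the latter case relation (1) applies. *)
Lemma atom_eq0 t c (X Y : {fset I}) (G : seq I) : cset A t = set0 ->
  c ** cproj t = c -> (forall a, a \in cheads t -> c ** S a = 0) ->
  (forall x, x \in X -> c ** Q x = c) -> (forall y, y \in Y -> c ** Q y = 0) ->
  (forall b, b \in cletters t -> [|| b \in X, b \in Y | b \in G]) -> c = 0.
Proof.
move=> t0; elim: G X Y c => [|b G ih] X Y c ct cS cX cY cG; last first.
  (* The letter b is undecided. The part c Q_b of the atom vanishes by induction with b added to X;
     this being known, induction applies to c itself with b added to Y. *)
  have cQ0 : c ** Q b = 0.
    apply: (ih (b |` X)%fset Y).
    - by rewrite -cmulA (cproj_commQ b t) cmulA ct.
    - by move=> a ah; rewrite -cmulA QS cmulrMn cS // mul0rn.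
    - move=> x; rewrite !inE => /orP[/eqP ->|xX]; first by rewrite -cmulA QQ.
      by rewrite -cmulA QC cmulA cX.
    - by move=> y yY; rewrite -cmulA QC cmulA cY // cmul0l.
    - by move=> x /cG; rewrite !inE -!orbA => /or4P[] ->; rewrite ?orbT.
  apply: (ih X (b |` Y)%fset) => //.
  - by move=> y; rewrite !inE => /orP[/eqP -> //|]; exact: cY.
  - by move=> x /cG; rewrite !inE -!orbA => /or4P[] ->; rewrite ?orbT.
have cQ b : b \in cletters t -> c ** Q b = c *+ (b \in X).
  move=> /cG; rewrite orbF; have [bX _|_ /= bY] := boolP (b \in X).
    by rewrite cX.
  by rewrite cY.
have := cval_cproj cQ cS; rewrite ct.
have [tX _|_ ->] := boolP (cval X t); last by [].
(* Here t is true on the atom. A letter j allowed by X and Y starts some point of the chain, and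
   this point would lie in the empty set of t unless j is a head; so relation (1) is available. *)
have sub j : Aprod A X Y j != 0%N -> j \in cheads t.
  move=> /Aprod_neq0[jX jY]; apply: contraT => jt.
  have [x xX x0] := markov_chain_start A_no_zero_row j.
  suff : cset A t x by rewrite t0.
  split=> //; rewrite (csem_cval (X := X)) ?x0 // => b /cG; rewrite orbF.
  have [bX _|_ /= bY] := boolP (b \in X); first by rewrite jX.
  exact: negPf (jY b bY).
have fin : finite_set [set j | Aprod A X Y j != 0%N].
  exact: sub_finite_set sub (finite_seq _).
(* Multiplied by c, the left side of relation (1) becomes c, while each term on the right begins
   with S_j for a head j, which c annihilates. *)
have := congr1 (cmul c) (EL_sum SE fin).
have cY' y : y \in Y -> c ** (u - Q y) = c.
  by move=> yY; rewrite cmulBr u_r cY // subr0.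
rewrite cmulA (big_cmul_fix cX) (big_cmul_fix cY') => ->.
rewrite cmul_suml big1 // => j _.
have [->|/sub jt] := eqVneq (Aprod A X Y j) 0%N; first by rewrite mulr0n cmul0r.
by rewrite cmulrMn cmulA cS // cmul0l mul0rn.
Qed.

Lemma cproj_empty t : cset A t = set0 -> cproj t = 0.
Proof.
move: {2}(cdepth t) (leqnn (cdepth t)) => n; elim: n t => [|n ih] t tn t0.
  apply: (atom_eq0 (X := fset0) (Y := fset0) (G := cletters t) t0) => //.
  - by case: (cprojP t).
  - by move=> a /cheads_depth; rewrite ltnNge tn.
apply: (atom_eq0 (X := fset0) (Y := fset0) (G := cletters t) t0) => //.
- by case: (cprojP t).
(* Writing S_a = S_a Q_a supplies the condition A a (x 0), without which [cshift a t] may be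
   nonempty although t is empty. *)
- move=> a _; rewrite cproj_cshift -(SQ a) -cmulA.
  rewrite [Q a ** _](ih _ _ (cset_shift_empty a t0)) ?cmul0r //=.
  rewrite max0n (leq_trans (cdepth_cshift _ _ _)) //.
  by rewrite -subn1 leq_subLR add1n.
Qed.

(** The expression for t without t' is empty, so its value 0 says that the projection of t lies
    below that of t'; then exchange the two. *)
Lemma cproj_cset t t' : cset A t = cset A t' -> cproj t = cproj t'.
Proof.
move=> e.
have le t1 t2 : cset A t1 = cset A t2 -> cproj t1 = cproj t1 ** cproj t2.
  move=> e1; apply/subr0_eq; rewrite -{1}[cproj t1]u_r -cmulBr.
  apply: (@cproj_empty (CAnd t1 (CNot t2))); rewrite -subset0.
  move=> x [xX /andP[x1 /negP[]]].
  by have : cset A t1 x by []; rewrite e1 => -[].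
by rewrite (le _ _ e) cproj_comm -(le _ _ (esym e)).
Qed.

Definition rho_letter (l : letter I) : U := if l.2 then star (S l.1) else S l.1.
Definition rho (w : seq (letter I)) : U :=
  foldr (fun l b => rho_letter l ** b) u w.

Lemma rho_letter_inv l : rho_letter (linv l) = star (rho_letter l).
Proof. by case: l => a []; rewrite /rho_letter /= ?starK. Qed.

Lemma rho_letter_isom l :
  rho_letter l ** (star (rho_letter l) ** rho_letter l) = rho_letter l.
Proof.
case: l => a []; rewrite /rho_letter /= ?starK; last exact: SQ.
by rewrite cmulA QsS.
Qed.

Lemma rho_letter_src l :
  star (rho_letter l) ** rho_letter l = cproj (if l.2 then CCons l.1 CTop else CQ l.1).
Proof. by case: l => a []; rewrite /rho_letter //= starK u_r. Qed.

Lemma rho_cat v w : rho (v ++ w) = rho v ** rho w.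
Proof. by elim: v => [|l v ih] /=; rewrite ?u_l // ih cmulA. Qed.

Lemma rho_winv w : rho (winv w) = star (rho w).
Proof.
elim: w => [|l w ih] /=; first by rewrite star_u.
by rewrite winv_cons rho_cat ih /= u_r rho_letter_inv starM.
Qed.

Lemma rho_range w : rho w ** star (rho w) = cproj (word_cylinder A w).
Proof.
elim: w => [|[a b] w ih] /=; first by rewrite star_u u_r.
rewrite starM -cmulA [rho w ** _]cmulA ih cmulA; case: b; rewrite /rho_letter //=.
by rewrite starK -cmulA cproj_cshift cmulA.
Qed.

Let rho_comm_letter w l :
  rho w ** star (rho w) ** (star (rho_letter l) ** rho_letter l) =
  star (rho_letter l) ** rho_letter l ** (rho w ** star (rho w)).
Proof. by rewrite rho_range rho_letter_src cproj_comm. Qed.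

(** A product of partial isometries need not be one. Here the range projection of the tail commutes
    with the source projection of the letter, both being values of [cproj]. *)
Lemma rho_isom w : is_partial_isometry (rho w).
Proof.
rewrite /is_partial_isometry; elim: w => [|l w ih] /=; first by rewrite star_u !u_l.
transitivity (rho_letter l ** (rho w ** star (rho w) **
    (star (rho_letter l) ** rho_letter l)) ** rho w).
  by rewrite starM !cmulA.
rewrite rho_comm_letter; transitivity (rho_letter l **
  (star (rho_letter l) ** rho_letter l) ** (rho w ** star (rho w) ** rho w)).
  by rewrite !cmulA.
by rewrite ih rho_letter_isom.
Qed.

(** If [w] starts with the inverse of [l], the two letters cancel up to the range projection of [l];
    otherwise this projection is absorbed by the letter itself. *)
Lemma rho_fcons l w :
  rho_letter l ** rho w = rho_letter l ** star (rho_letter l) ** rho (fcons l w).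
Proof.
have e b : rho_letter l ** b =
    rho_letter l ** star (rho_letter l) ** (rho_letter l ** b).
  by rewrite !cmulA -(cmulA (rho_letter l)) rho_letter_isom.
case: w => [|m w] /=; first by rewrite -e.
case: eqVneq => [->|_] /=; first by rewrite rho_letter_inv cmulA.
exact: e.
Qed.

Lemma rho_wmul v w : rho v ** rho w = rho v ** star (rho v) ** rho (wmul v w).
Proof.
elim: v => [|l v ih] /=; first by rewrite star_u !u_l.
rewrite -cmulA ih starM.
transitivity (rho_letter l ** (star (rho_letter l) ** rho_letter l **
   (rho v ** star (rho v))) ** rho (wmul v w)).
  by rewrite [rho_letter l ** (_ ** (rho v ** _))]cmulA rho_letter_isom !cmulA.
rewrite -rho_comm_letter.
transitivity (rho_letter l ** (rho v ** star (rho v)) ** star (rho_letter l) **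
  (rho_letter l ** rho (wmul v w))); first by rewrite !cmulA.
rewrite rho_fcons; transitivity (rho_letter l ** (rho v ** star (rho v)) **
  (star (rho_letter l) ** rho_letter l ** star (rho_letter l)) **
  rho (fcons l (wmul v w))).
  by rewrite !cmulA.
have -> : star (rho_letter l) ** rho_letter l ** star (rho_letter l) =
    star (rho_letter l).
  by rewrite -[in RHS](rho_letter_isom l) !starM starK.
by rewrite !cmulA.
Qed.

(** Uses an arbitrary expression for V, harmless by [cproj_cset]; the value 0 is a default for sets
    without one. *)
Definition phi_cset (V : set (nat -> I)) : U :=
  if pselect (exists t, V = cset A t) is left h then cproj (sval (cid h)) else 0.

Lemma phi_csetE t : phi_cset (cset A t) = cproj t.
Proof.
rewrite /phi_cset; case: pselect => [h|[]]; last by exists t.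
by case: (cid h) => t' /= e; apply/esym/cproj_cset.
Qed.

Theorem rho_system_relations :
  system_relations (markov_system A) (fun g : freegrp I => rho (fword g)).
Proof.
set rproj := fun g : freegrp I => rho (fword g) ** star (rho (fword g)).
have uP : is_unit u := EL_unit SE.
have BA : forall V, system_boolean_algebra (markov_system A) V ->
    exists2 t, V = cset A t & cstar_gen (range rproj) (cproj t).
  have [[g0 gD gZ gM gS] _] := cstar_gen_subalgebra (range rproj).
  have gu : cstar_gen (range rproj) u.
    apply: cstar_gen_incl; exists 1%g => //.
    by rewrite /rproj /= star_u u_l.
  have gB a b : cstar_gen (range rproj) a -> cstar_gen (range rproj) b ->
      cstar_gen (range rproj) (a - b).
    by apply: subalgebraB; exact: cstar_gen_subalgebra.
  apply: (smallest_sub (X := [set V | exists2 t, V = cset A t &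
    cstar_gen (range rproj) (cproj t)])).
    split=> [|? ? [t -> tg] [t' -> tg']|? ? [t -> tg] [t' -> tg']|? [t -> tg]].
    - exists CTop => //; apply/seteqP; split=> [x //|x []//].
    - by exists (CAnd t t'); [exact: csetI|exact: gM].
    - exists (CNot (CAnd (CNot t) (CNot t'))); first exact: csetU.
      by apply: (gB) => //; apply: gM; exact: gB.
    - by exists (CNot t); [exact: csetC|exact: gB].
  move=> _ [g _ <-]; exists (word_cylinder A (fword g)).
    exact: word_dom_cylinder.
  by apply: cstar_gen_incl; exists g => //; exact: rho_range.
split.
- split=> [g|g h]; first exact: rho_isom.
  by rewrite !rho_range cproj_comm.
- exact: uP.
- by move=> g; exact: rho_winv.
- by move=> h i; exact: rho_wmul.
exists phi_cset; split.
- move=> g; rewrite /= /markov_dom word_dom_cylinder phi_csetE.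
  by rewrite rho_range.
- by move=> V /BA[t -> tg]; rewrite phi_csetE; split=> //; exact: cprojP.
- by move=> V W /BA[t -> _] /BA[t' -> _]; rewrite csetI !phi_csetE.
- move=> V W /BA[t -> _] /BA[t' -> _]; rewrite csetU !phi_csetE /=.
  exact: unit_compl_mul.
- by move=> V /BA[t -> _]; rewrite csetC !phi_csetE.
Qed.

End FromExelLaca.

(** * The representation on the square summable functions on the chain *)

Section CompositionOperators.
Variables (R : realType) (E : choiceType).
Local Notation C := (R[i]%C).

Definition pcomp (D : pred E) (c : E -> E) (a : E -> C) : E -> C^o :=
  fun y => if D y then a (c y) else 0.

Definition partial_inverse (D D' : pred E) (c c' : E -> E) :=
  (forall y, D y -> D' (c y) /\ c' (c y) = y) /\
  (forall x, D' x -> D (c' x) /\ c (c' x) = x).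

Lemma partial_inverse_sym D D' c c' :
  partial_inverse D D' c c' -> partial_inverse D' D c' c.
Proof. by case. Qed.

Section PartialBijection.
Variables (D D' : pred E) (c c' : E -> E).
Hypothesis cP : partial_inverse D D' c c'.

Lemma psum_pcomp (b : E -> C) (B : {fset E}) :
  psum (pcomp D c b) B = psum b [fset c y | y in [fset y in B | D y]]%fset.
Proof.
rewrite /psum big_imfset; last first.
  move=> y z /=; rewrite !inE => /andP[_ Dy] /andP[_ Dz] e.
  by rewrite -(proj2 (proj1 cP y Dy)) e (proj2 (proj1 cP z Dz)).
by rewrite /pcomp -big_mkcond /= big_fset_condE.
Qed.

Lemma pcomp_sqr (a : E -> C) :
  (fun y => `|pcomp D c a y| ^+ 2) = pcomp D c (fun x => `|a x| ^+ 2).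
Proof.
by apply/funext => y; rewrite /pcomp; case: ifP => // _; rewrite normr0 expr0n.
Qed.

Lemma pcomp_summable (u : l2 R E) : pcomp D c u \in @square_summable R E.
Proof.
have /asboolP[k uk] := l2funP u; apply/asboolP; exists k => B.
by rewrite pcomp_sqr psum_pcomp.
Qed.

Definition l2_pcomp u := L2 (pcomp_summable u).

Lemma l2_pcomp_bounded u : `|l2_pcomp u| <= 1 * `|u|.
Proof.
rewrite mul1r -(ler_pXn2r (n := 2)) ?nnegrE // -!l2_ip_norm.
by apply: l2_ip_le => B; rewrite pcomp_sqr psum_pcomp l2_psum_le.
Qed.

End PartialBijection.

Lemma l2_pcomp_adjoint D D' c c' (cP : partial_inverse D D' c c')
    (cP' : partial_inverse D' D c' c) :
  is_adjoint (l2_pcomp cP) (l2_pcomp cP').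
Proof.
move=> u v; apply: l2_ip_unique; apply/cvgrPdist_lt => e e0.
pose b x := u x * (l2_pcomp cP' v x)^*%R.
have b0 x : ~~ D' x -> b x = 0.
  by move=> /negPf Dx; rewrite /b /= /pcomp Dx conjC0 mulr0.
have -> : (fun x => l2_pcomp cP u x * (v x)^*%R) = pcomp D c b.
  apply/funext => y; rewrite /= /pcomp; case: ifPn => Dy; last by rewrite mul0r.
  by have [Dc cc] := proj1 cP y Dy; rewrite /b /= /pcomp Dc cc.
move/cvgrPdist_lt: (@l2_ip_cvg R E u (l2_pcomp cP' v)) => /(_ e e0)[B0 _ BP].
(* Once B contains c'(B0), its image under c contains all points of B0 in D'. As b vanishes off D',
   the rest of B0 can be added to the index set without changing the sum. *)
exists [fset c' x | x in B0]%fset => // B /= /fsubsetP BB.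
rewrite (psum_pcomp cP) {1}/psum.
have /BP : fsubset B0 ([fset c y | y in [fset y in B | D y]] `|` B0)%fset.
  exact: fsubsetUr.
rewrite /= /psum => h; rewrite (big_fset_incl _ (fsubsetUl _ B0)) //= => x.
rewrite inE => /orP[->//|xB] xI; apply: b0; apply: contra xI => Dx.
have [Dc cc] := proj2 cP x Dx; apply/imfsetP; exists (c' x) => //.
by rewrite !inE Dc andbT; apply: BB; apply/imfsetP; exists x.
Qed.

Lemma l2_pcomp_adjointable D D' c c' (cP : partial_inverse D D' c c') :
  l2_pcomp cP \in @adjointable R (l2 R E).
Proof.
apply/asboolP; split; last by exists 1 => u; exact: l2_pcomp_bounded.
by exists (l2_pcomp (partial_inverse_sym cP)); exact: l2_pcomp_adjoint.
Qed.

Definition pcomp_op D D' c c' (cP : partial_inverse D D' c c') :=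
  Operator (l2_pcomp_adjointable cP).

Lemma star_pcomp_op D D' c c' (cP : partial_inverse D D' c c') :
  star (pcomp_op cP) = pcomp_op (partial_inverse_sym cP).
Proof. apply: val_inj; apply: op_star_eq; exact: l2_pcomp_adjoint. Qed.

Lemma id_adjointable : id \in @adjointable R (l2 R E).
Proof.
apply/asboolP; split; first by exists id.
by exists 1 => u; rewrite mul1r.
Qed.

Definition id_op := Operator id_adjointable.

Lemma id_op_unit : is_unit id_op.
Proof. by move=> T; split; exact: op_ext. Qed.

Lemma indicator_summable z : (fun x => (x == z)%:R : C^o) \in @square_summable R E.
Proof.
apply/asboolP; exists 1 => B.
apply: le_trans (psum_mono _ (fsubsetUr [fset z]%fset B)) _.
  by move=> x; rewrite exprn_ge0.
rewrite /psum (big_fsetD1 z) ?inE ?eqxx //= normr1 expr1n.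
rewrite big1_fset ?addr0 // => x; rewrite !inE => /andP[/negPf -> _] _.
by rewrite normr0 expr0n.
Qed.

Definition l2_delta z := L2 (indicator_summable z).

End CompositionOperators.

Section FiniteAprod.
Variables (I : choiceType) (A : I -> I -> bool).

Lemma AprodE (X Y : {fset I}) j :
  Aprod A X Y j = (all (A^~ j) X && all (fun y => ~~ A y j) Y) :> nat.
Proof.
rewrite -mulnb; congr muln.
  by elim: (enum_fset X) => [|x s ih]; rewrite ?big_nil // big_cons ih /= mulnb.
elim: (enum_fset Y) => [|y s ih]; rewrite ?big_nil // big_cons ih /=.
by rewrite -mulnb; case: (A y j).
Qed.

(** The finite set is chosen before the algebra, so that one set serves the sums in [U] and in
    [adjoin_unit U] alike. *)
Lemma EL_sumE (X Y : {fset I}) : finite_set [set j | Aprod A X Y j != 0%N] ->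
  exists2 r : {fset I}, forall j, (j \in r) = (Aprod A X Y j != 0%N) &
  forall (R : realType) (U : cstarType R) (S : I -> U),
    \sum_(j \in [set: I]) (S j ** star (S j)) *+ Aprod A X Y j =
    \sum_(j <- r) S j ** star (S j).
Proof.
move=> /finite_fsetP[r rE]; have rP j : (j \in r) = (Aprod A X Y j != 0%N).
  have e : is_true (Aprod A X Y j != 0%N) = is_true (j \in r) := congr1 (@^~ j) rE.
  by apply/idP/idP; rewrite e.
exists r => // R U S; rewrite (fsbigTE r); last first.
  by move=> j; rewrite rP negbK => /eqP ->; rewrite mulr0n.
apply: eq_big_seq => j; rewrite rP AprodE.
by case: (_ && _) => //; rewrite mulr1n.
Qed.

End FiniteAprod.

Section MarkovModel.
Variables (R : realType) (I : choiceType) (A : I -> I -> bool).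
Local Notation C := (R[i]%C).

Definition markov_point : choiceType := set_type (markov_chain A).
Implicit Types x y : markov_point.

Definition mhead x : I := val x 0%N.

Lemma shift_markov x : shift_seq (val x) \in markov_chain A.
Proof. by apply/mem_set => k; have /set_mem := valP x; apply. Qed.

Definition mshift x : markov_point := SigSub (shift_markov x).

(** When a x is not in the chain, [insubd] returns x; this default is masked by the domain in
    [mshift_mcons]. *)
Definition mcons a x : markov_point := insubd x (cons_seq a (val x)).

Lemma val_mcons a x : A a (mhead x) -> val (mcons a x) = cons_seq a (val x).
Proof.
move=> ax; rewrite val_insubd mem_set //; case=> [|k] //=.
by have /set_mem := valP x; apply.
Qed.

Lemma mshiftP x : A (mhead x) (mhead (mshift x)).
Proof. by have /set_mem := valP x; apply. Qed.

Lemma mshiftK a x : mhead x == a -> mcons a (mshift x) = x.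
Proof.
move=> /eqP <-; apply: val_inj; rewrite val_mcons ?mshiftP //.
by apply/funext => -[|k].
Qed.

Lemma mconsK a x : A a (mhead x) -> mshift (mcons a x) = x.
Proof.
move=> ax; apply: val_inj; rewrite /= val_mcons //.
Qed.

Lemma mhead_mcons a x : A a (mhead x) -> mhead (mcons a x) = a.
Proof. by move=> ax; rewrite /mhead val_mcons. Qed.

Lemma mshift_mcons a : partial_inverse (fun x => mhead x == a)
  (fun x => A a (mhead x)) mshift (mcons a).
Proof.
split=> x.
  move=> xa; rewrite mshiftK // -{1}(eqP xa); split=> //; exact: mshiftP.
by move=> ax; rewrite mconsK // mhead_mcons.
Qed.

Definition model_op a : operator (l2 R markov_point) := pcomp_op R (mshift_mcons a).

Lemma model_opE a (u : l2 R markov_point) x :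
  model_op a u x = if mhead x == a then u (mshift x) else 0.
Proof. by []. Qed.

Lemma model_op_starE a (u : l2 R markov_point) x :
  star (model_op a) u x = if A a (mhead x) then u (mcons a x) else 0.
Proof. by rewrite star_pcomp_op. Qed.

Lemma model_srcE a (u : l2 R markov_point) x :
  (star (model_op a) ** model_op a) u x = if A a (mhead x) then u x else 0.
Proof.
rewrite [LHS]model_op_starE; case: ifP => // ax.
by rewrite model_opE mhead_mcons // eqxx mconsK.
Qed.

Lemma model_rangeE a (u : l2 R markov_point) x :
  (model_op a ** star (model_op a)) u x = if mhead x == a then u x else 0.
Proof.
rewrite [LHS]model_opE; case: ifP => // xa.
by rewrite model_op_starE -{1}(eqP xa) mshiftP mshiftK.
Qed.
Definition is_multiplier (T : operator (l2 R markov_point)) (p : pred markov_point) :=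
  forall (u : l2 R markov_point) x, T u x = if p x then u x else 0.

Lemma multiplier_mul S T p q : is_multiplier S p -> is_multiplier T q ->
  is_multiplier (S ** T) (predI p q).
Proof.
move=> Sp Tq u x; rewrite [LHS]Sp /=; case: (p x) => //=; exact: Tq.
Qed.

Lemma multiplier_compl T p : is_multiplier T p ->
  is_multiplier (id_op R markov_point - T) (fun x => ~~ p x).
Proof.
move=> Tp u x; transitivity (u x - T u x) => //; rewrite Tp.
by case: (p x); rewrite ?subrr ?subr0.
Qed.

Lemma multiplier_big (J : Type) (s : seq J) F (p : J -> pred markov_point) :
  (forall j, is_multiplier (F j) (p j)) ->
  is_multiplier (\big[@cmul R _/id_op R markov_point]_(j <- s) F j)
    (fun x => all (p^~ x) s).
Proof.
move=> Fp; elim: s => [|j s ih] u x; rewrite ?big_nil // big_cons.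
exact: multiplier_mul (Fp j) ih u x.
Qed.

Lemma op_sum_apply (J : Type) (s : seq J) (F : J -> operator (l2 R markov_point))
    (u : l2 R markov_point) x :
  (\sum_(j <- s) F j) u x = \sum_(j <- s) F j u x.
Proof. by elim: s => [|j s ih]; rewrite ?big_nil // !big_cons -ih. Qed.

(** Source and range projections are multiplications by indicators, so relations between them become
    pointwise identities of truth values. At each point at most one term of the sum in relation (1)
    is nonzero, that of the first letter. *)
Lemma model_unital_EL : unital_EL A (id_op R markov_point) model_op.
Proof.
have srcP a : is_multiplier (star (model_op a) ** model_op a)
    (fun x => A a (mhead x)) by move=> u x; exact: model_srcE.
split.
- exact: id_op_unit.
- move=> a; apply: op_ext => u; apply: l2_ext => x.
  rewrite /is_partial_isometry -cmulA [LHS]model_opE; case: ifP => xa; last first.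
    by rewrite model_opE xa.
  by rewrite model_srcE -{1}(eqP xa) mshiftP model_opE xa.
- move=> X Y /EL_sumE[r rP ->]; apply: op_ext => u; apply: l2_ext => x.
  have mX := multiplier_big X srcP.
  have mY := multiplier_big Y (fun a => multiplier_compl (srcP a)).
  rewrite [LHS](multiplier_mul mX mY) op_sum_apply.
  have -> : [predI (fun x => all ((fun a x => A a (mhead x))^~ x) X) &
      (fun x => all ((fun a x => ~~ A a (mhead x))^~ x) Y)] x =
      (mhead x \in r).
    by rewrite rP AprodE /=; case: (_ && _).
  under eq_bigr do rewrite model_rangeE.
  have [xr|xr] := boolP (mhead x \in r).
    rewrite (big_fsetD1 _ xr) /= eqxx big1_fset ?addr0 // => j.
    by rewrite !inE eq_sym => /andP[/negPf ->].
  rewrite big1_seq // => j /= jr; case: eqP => // e.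
  by rewrite e jr in xr.
- move=> a b; apply: op_ext => u; apply: l2_ext => x.
  rewrite [LHS](multiplier_mul (srcP a) (srcP b)).
  by rewrite [RHS](multiplier_mul (srcP b) (srcP a)) /= andbC.
- move=> a b ab; apply: op_ext => u; apply: l2_ext => x.
  rewrite [LHS]model_op_starE; case: ifP => // ax.
  by rewrite model_opE mhead_mcons //; case: eqP.
- move=> a b; apply: op_ext => u; apply: l2_ext => x.
  rewrite [LHS]srcP; have -> (c : bool) :
      (model_op b *+ c) u x = if c then model_op b u x else 0 by case: c.
  by rewrite model_opE; case: eqP => [->|_] //; do !case: ifP.
Qed.

Lemma model_cproj t : is_multiplier
  (cproj (id_op R markov_point) model_op t) (fun x => csem A t (val x)).
Proof.
elim: t => [|b|t1 h1 t2 h2|t h|a t h] //=.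
- by move=> u x; exact: model_srcE.
- exact: multiplier_mul.
- exact: multiplier_compl.
move=> u x; rewrite -cmulA [LHS]model_opE -[val x 0%N]/(mhead x).
case: ifP => // xa; rewrite [LHS]h; case: ifP => //= _.
by rewrite model_op_starE -{1}(eqP xa) mshiftP mshiftK.
Qed.

(** The test vector is the indicator of the shift of x: the operator of the first letter gives it
    the value 1 at x, and the multiplication by t keeps this value. *)
Lemma model_cproj_neq0 t (x : nat -> I) : cset A t x ->
  cproj (id_op R markov_point) model_op t ** model_op (x 0%N) <> 0.
Proof.
move=> [xX xt] /(congr1 val) /(congr1 (fun T => T (l2_delta R (mshift
  (SigSub (mem_set xX : x \in markov_chain A)))))).
set x' := SigSub _ => /(congr1 val)/(congr1 (@^~ x')) e.
have : cproj (id_op R markov_point) model_op t (model_op (x 0%N)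
    (l2_delta R (mshift x'))) x' = 0 by exact: e.
rewrite model_cproj xt model_opE /= /mhead eqxx eqxx => /eqP.
by rewrite oner_eq0.
Qed.

End MarkovModel.

(** * Exel-Laca families inside the algebra of the system *)

Section SystemRelations.
Variables (R : realType) (I : choiceType) (A : I -> I -> bool).
Variables (U : cstarType R) (s : freegrp I -> U).
Hypothesis sP : system_relations (markov_system A) s.

Local Notation S := (fun i => s (fgen i)).
Local Notation p := (cproj (s 1%g) S).

(* Boolean expressions in the domains of the letters and their inverses only. *)
Fixpoint cflat (t : cylinder I) : bool :=
  match t with
  | CTop | CQ _ | CCons _ CTop => true
  | CAnd t1 t2 => cflat t1 && cflat t2
  | CNot t => cflat t
  | CCons _ _ => false
  end.

Let s_unit : is_unit (s 1%g). Proof. by case: sP. Qed.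
Let u_l a : s 1%g ** a = a. Proof. by case: (s_unit a). Qed.
Let u_r a : a ** s 1%g = a. Proof. by case: (s_unit a). Qed.
Let s_isom g : is_partial_isometry (s g). Proof. by case: sP => -[]. Qed.
Let s_inv g : s g^-1%g = star (s g). Proof. by case: sP. Qed.

(** The leaves of a flat expression are domains, where [phi] takes the value [p]; being a Boolean
    homomorphism, [phi] agrees with [p] on the whole expression. Exel-Laca relations thus reduce to
    equalities of sets. *)
Lemma flat_cset t t' : cflat t -> cflat t' -> cset A t = cset A t' -> p t = p t'.
Proof.
have [_ _ _ _ [phi [phiD _ phiI _ phiC]]] := sP.
pose BA := system_boolean_algebra (markov_system A).
have BAX V : BA V -> BA (markov_chain A `\` V).
  by move=> BV W [WB Wg]; case: (WB) => _ _ _; apply; apply: BV.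
have BAI V W : BA V -> BA W -> BA (V `&` W).
  by move=> BV BW Z [ZB Zg]; case: (ZB) => _ h _ _; apply: h; [apply: BV|apply: BW].
have BAg g : BA (pdom (markov_system A) g) by move=> W [_]; apply; exists g.
have key t1 : cflat t1 -> BA (cset A t1) /\ phi (cset A t1) = p t1.
  elim: t1 => [|b|t1 h1 t2 h2|t1 h1|a t1 _] /=.
  - move=> _; rewrite -(word_dom_cylinder A [::]); split; first exact: (BAg 1%g).
    by rewrite (phiD 1%g) star_unit // u_l.
  - move=> _; rewrite (_ : cset A (CQ b) = pdom (markov_system A) (fgen b)^-1%g).
      by split=> //; rewrite phiD s_inv starK.
    rewrite /= /markov_dom word_dom_cylinder.
    by apply/seteqP; split=> x [xX xb]; split=> //; move: xb; rewrite /= ?andbT.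
  - move=> /andP[/h1[B1 p1] /h2[B2 p2]]; rewrite -csetI; split; first exact: BAI.
    by rewrite phiI // p1 p2.
  - by move=> /h1[B1 p1]; rewrite -csetC phiC // p1; split=> //; exact: BAX.
  case: t1 => // _; rewrite -(word_dom_cylinder A [:: (a, false)]).
  by split; [exact: (BAg (fgen a))|rewrite (phiD (fgen a)) /= u_r].
by move=> /key[_ <-] /key[_ <-] ->.
Qed.

Lemma cproj_or t t' : p (CNot (CAnd (CNot t) (CNot t'))) = p t + p t' - p t ** p t'.
Proof.
exact: unit_compl_mul.
Qed.

Let orth i j : i <> j -> (S i ** star (S i)) ** (S j ** star (S j)) = 0.
Proof.
move=> ij.
have := @flat_cset (CAnd (CCons i CTop) (CCons j CTop)) (CNot CTop) erefl erefl.
rewrite /= !u_r subrr; apply; apply/seteqP; split=> x [xX] //=.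
by case/andP => /andP[/eqP -> _] /andP[/eqP].
Qed.

Lemma system_unital_EL : unital_EL A (s 1%g) S.
Proof.
split.
- exact: s_unit.
- by move=> i; exact: s_isom.
- move=> X Y /EL_sumE[r rP ->].
  pose tX := foldr (fun a t => CAnd (CQ a) t) CTop X.
  pose tY := foldr (fun a t => CAnd (CNot (CQ a)) t) CTop Y.
  pose tr := foldr (fun j t => CNot (CAnd (CNot (CCons j CTop)) (CNot t)))
    (CNot CTop) r.
  have pX : p tX = \big[@cmul R U/s 1%g]_(x <- X) (star (S x) ** S x).
    by rewrite /tX; elim: (enum_fset X) => [|x q ih]; rewrite ?big_nil ?big_cons //= ih.
  have pY : p tY = \big[@cmul R U/s 1%g]_(y <- Y) (s 1%g - star (S y) ** S y).
    by rewrite /tY; elim: (enum_fset Y) => [|y q ih]; rewrite ?big_nil ?big_cons //= ih.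
  (* By orthogonality the product in a + b - ab vanishes, so the disjunction over distinct first
     letters is a sum. *)
  have pr : p tr = \sum_(j <- r) S j ** star (S j).
    rewrite /tr; elim: (enum_fset r) (fset_uniq r) => [|j q ih] /=.
      by rewrite big_nil subrr.
    move=> /andP[jq uq]; rewrite big_cons -ih //.
    rewrite [LHS](cproj_or (CCons j CTop)) /= u_r ih // cmul_suml.
    rewrite [X in _ - X]big1_seq ?subr0 // => k /= kq.
    by apply: orth => e; rewrite e kq in jq.
  have fX : cflat tX by rewrite /tX; elim: (enum_fset X).
  have fY : cflat tY by rewrite /tY; elim: (enum_fset Y).
  have fr : cflat tr by rewrite /tr; elim: (enum_fset r).
  have semX x : csem A tX x = all (fun a => A a (x 0%N)) X.
    by rewrite /tX; elim: (enum_fset X) => //= a q ->.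
  have semY x : csem A tY x = all (fun a => ~~ A a (x 0%N)) Y.
    by rewrite /tY; elim: (enum_fset Y) => //= a q ->.
  have semr x : csem A tr x = (x 0%N \in r).
    rewrite /tr -[x 0%N \in r]/(x 0%N \in enum_fset r).
    elim: (enum_fset r) => //= a q ->.
    by rewrite negb_and !negbK andbT inE.
  rewrite -pX -pY -pr; apply: (@flat_cset (CAnd tX tY)) => //=; first by rewrite fX.
  by apply/seteqP; split=> x [xX xt]; split=> //; move: xt;
    rewrite /= semX semY semr rP AprodE; case: (_ && _).
- move=> i j; apply: (@flat_cset (CAnd (CQ i) (CQ j)) (CAnd (CQ j) (CQ i))) => //.
  by apply/seteqP; split=> x [xX xt]; split=> //; move: xt; rewrite /= andbC.
- move=> i j ij; rewrite -(s_isom (fgen j)) -[in star _](s_isom (fgen i)).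
  rewrite !starM starK.
  transitivity (star (S i) ** ((S i ** star (S i)) ** (S j ** star (S j))) ** S j).
    by rewrite !cmulA.
  by rewrite orth // cmul0r cmul0l.
- move=> i j; rewrite -{1}(s_isom (fgen j)) -{4}(s_isom (fgen j)).
  have : p (CAnd (CQ i) (CCons j CTop)) =
      p (if A i j then CCons j CTop else CNot CTop).
    apply: flat_cset; [by []|by case: (A i j)|].
    apply/seteqP; split=> x [xX xt]; split=> //; move: xt;
      case: (boolP (A i j)) => Aij //=.
    + by rewrite andbT => /andP[].
    + by rewrite andbT => /andP[+ /eqP xj]; rewrite xj (negPf Aij).
    + by rewrite andbT => /eqP ->; rewrite Aij eqxx.
  rewrite /= u_r => e; rewrite cmulA e; case: (A i j) => /=.
    by rewrite u_r mulr1n.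
  by rewrite subrr cmul0l mulr0n.
Qed.

(** For a reduced word the domain of l w is contained in that of l, so the range projection s_g
    s_g^* in the product relation is absorbed by s_gh. *)
Lemma system_cons l (w : seq (letter I)) (lw : reduced (l :: w)) :
  s (FreeGrp lw) = s (@FreeGrp I [:: l] isT) ** s (FreeGrp (reduced_tl lw)).
Proof.
have [_ _ _ mul [phi [phiD _ phiI _ _]]] := sP.
set g := @FreeGrp I [:: l] isT; set h := FreeGrp (reduced_tl lw).
have gh : (g * h)%g = FreeGrp lw by apply: val_inj; exact: fconsE.
rewrite mul gh -[in RHS](s_isom (FreeGrp lw)) !cmulA.
rewrite -(cmulA (s g ** star (s g)) (s _)) -(phiD g) -(phiD (FreeGrp lw)).
rewrite -phiI; last 2 first.
- by move=> W [_]; apply; exists g.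
- by move=> W [_]; apply; exists (FreeGrp lw).
have -> : pdom (markov_system A) g `&` pdom (markov_system A) (FreeGrp lw) =
    pdom (markov_system A) (FreeGrp lw).
  apply/setIidPr => x [y [yw yl] <-]; exists y => //; split=> //.
  exact: letter_dom_sub yl.
by rewrite phiD s_isom.
Qed.

Lemma system_generated g :
  cstar_gen ([set e | is_unit e] `|` range S) (s g).
Proof.
set G := cstar_gen _; have [[_ _ _ GM GS] _] : is_cstar_subalgebra G.
  exact: cstar_gen_subalgebra.
have Gl l : G (s (@FreeGrp I [:: l] isT)).
  case: l => a []; last by apply: cstar_gen_incl; right; exists a.
  rewrite (_ : FreeGrp _ = (fgen a)^-1%g); last exact: val_inj.
  by rewrite s_inv; apply: GS; apply: cstar_gen_incl; right; exists a.
case: g => w; elim: w => [|l w ih] lw.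
  rewrite (_ : FreeGrp lw = 1%g); last exact: val_inj.
  by apply: cstar_gen_incl; left; exact: s_unit.
by rewrite system_cons; apply: GM => //; exact: Gl.
Qed.

End SystemRelations.

(** * Relation (1) when the generated algebra may lack a unit *)

Section UnitalToNonunital.
Variables (R : realType) (I : choiceType) (A : I -> I -> bool).
Variables (U : cstarType R) (u : U) (S : I -> U).
Hypothesis SE : unital_EL A u S.

Let u_l a : u ** a = a. Proof. by case: (EL_unit SE a). Qed.
Let u_r a : a ** u = a. Proof. by case: (EL_unit SE a). Qed.

Definition adj_out (B : cstarType R) (f : B -> U) (x : adjoin_unit B) : U :=
  f x.1 + x.2 *: u.

Lemma adj_out_hom (B : cstarType R) (f : B -> U) :
  is_star_hom f -> is_star_hom (adj_out f).
Proof.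
move=> fH; split=> [x y|k x|x y|x]; rewrite /adj_out.
- by rewrite (homD fH) scalerDl addrACA.
- by rewrite (homZ fH) scalerDr scalerA.
- rewrite !(homD fH) !(homZ fH) (homM fH) cmulDl !cmulDr !(cmulZl, cmulZr).
  by rewrite u_l !u_r scalerA -!addrA; congr (_ + _); rewrite addrCA.
- by rewrite (hom_star fH) starD starZ (star_unit (EL_unit SE)).
Qed.

Lemma adj_out_one (B : cstarType R) (f : B -> U) :
  is_star_hom f -> adj_out f (adj_one B) = u.
Proof. by move=> fH; rewrite /adj_out (hom0 fH) add0r scale1r. Qed.

Lemma adj_out_in (B : cstarType R) (f : B -> U) b : adj_out f (adj_in b) = f b.
Proof. by rewrite /adj_out scale0r addr0. Qed.

(** Only the reading of 1 in relation (1) is at stake. If J has a unit, it is [u]; if not, [adj_out]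
    carries the relation over the adjoined unit to the given one in [U], and scalar parts are
    compared separately. *)
Lemma unital_EL_relations :
  (forall e, cstar_gen (range S) e ->
     (forall a, cstar_gen (range S) a -> e ** a = a /\ a ** e = a) -> e = u) ->
  EL_relations A S.
Proof.
move=> e_u; split.
- exact: EL_isom SE.
- split=> [e [eG e1]|noe]; first by rewrite (e_u e); [exact: EL_sum SE| |].
  move=> X Y fin; have [r rP sumE] := EL_sumE fin.
  have outH := adj_out_hom (id_star_hom U).
  have out1 := adj_out_one (id_star_hom U).
  have bigE (J : Type) (q : seq J) F :
      adj_out id (\big[@cmul R _/adj_one U]_(j <- q) F j) =
      \big[@cmul R U/u]_(j <- q) adj_out id (F j).
    by elim: q => [|j q ih]; rewrite ?big_nil ?out1 // !big_cons (homM outH) ih.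
  have sndM (x y : adjoin_unit U) : (x ** y).2 = x.2 * y.2 by [].
  have sndD (x y : adjoin_unit U) : (x + y).2 = x.2 + y.2 by [].
  (* [adj_out] merges the vector and the scalar part, so it separates elements only once their
     scalar parts agree. *)
  have eqE (x y : adjoin_unit U) : x.2 = y.2 -> adj_out id x = adj_out id y -> x = y.
    case: x y => x k [y l] /= <-; rewrite /adj_out /= => /addIr -> //.
  have sE : adj_out id (\sum_(j <- r) adj_in (S j) ** star (adj_in (S j))) =
      \sum_(j <- r) S j ** star (S j).
    rewrite (hom_sum outH); apply: eq_bigr => j _.
    by rewrite (homM outH) (hom_star outH) adj_out_in.
  have s2 : (\sum_(j <- r) adj_in (S j) ** star (adj_in (S j))).2 = 0.
    elim: (enum_fset r) => [|j q ih]; rewrite ?big_nil // big_cons.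
    by rewrite sndD ih addr0 sndM mul0r.
  have main := EL_sum SE fin; rewrite sumE in main.
  rewrite sumE; apply: eqE; last first.
    rewrite sE -main (homM outH) !bigE; congr (_ ** _); apply: eq_bigr => j _.
      by rewrite (homM outH) (hom_star outH) adj_out_in.
    by rewrite (homB outH) out1 (homM outH) (hom_star outH) adj_out_in.
  rewrite s2 sndM; have [X0|[x xX]] := fset_0Vmem X; last first.
    rewrite (_ : (\big[_/_]_(x <- X) _).2 = 0) ?mul0r //.
    rewrite -[x \in X]/(x \in enum_fset X) in xX.
    elim: (enum_fset X) xX => //= z q ih _; rewrite big_cons sndM.
    by rewrite [X in X * _](_ : _ = 0) ?mul0r //; exact: mulr0.
  have [[G0 GD _ GM GS] _] := cstar_gen_subalgebra (range S).
  have GSi i : cstar_gen (range S) (S i) by apply: cstar_gen_incl; exists i.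
  have GB a b := @subalgebraB _ _ _ a b (cstar_gen_subalgebra (range S)).
  (* For X empty the scalar parts would differ. But relation (1) then equates the product of the u -
     S_y^* S_y with a sum in J, and u minus this product is in J as well; so J would contain u. *)
  exfalso; apply: noe; exists u; suff uG : cstar_gen (range S) u by [].
  rewrite X0 [in LHS]big_nil u_l in main.
  have GY : cstar_gen (range S)
      (u - \big[@cmul R U/u]_(y <- Y) (u - star (S y) ** S y)).
    elim: (enum_fset Y) => [|y q ih]; first by rewrite big_nil subrr.
    rewrite big_cons cmulBl u_l opprB addrCA addrC; apply: (GD) => //.
    set b := \big[_/_]_(_ <- _) _ in ih *.
    rewrite (_ : _ ** b = star (S y) ** S y - star (S y) ** S y ** (u - b)).
      by apply: (GB); [|apply: (GM) => //]; apply: (GM) => //; exact: GS.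
    by rewrite cmulBr u_r subKr.
  rewrite -(subrK (\big[@cmul R U/u]_(y <- Y) (u - star (S y) ** S y)) u) main.
  rewrite -{1}main; apply: (GD) => //.
  elim: (enum_fset r) => [|j q ih]; rewrite ?big_nil // big_cons.
  by apply: (GD) => //; apply: (GM) => //; exact: GS.
- exact: EL_comm SE.
- exact: EL_orth SE.
- exact: EL_shift SE.
Qed.

End UnitalToNonunital.

(** * The unit of the C*-algebra generated by the letters *)

Section SystemUnit.
Variables (R : realType) (I : choiceType) (A : I -> I -> bool).
Hypothesis A_no_zero_row : forall i, exists j, A i j.
Variables (U : cstarType R) (s : freegrp I -> U).
Hypothesis U_s : is_system_algebra (markov_system A) s.

Local Notation S := (fun i => s (fgen i)).
Local Notation p := (cproj (s 1%g) S).
Local Notation J := (cstar_gen (range S)).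

Let sP : system_relations (markov_system A) s. Proof. by case: U_s. Qed.
Let SE : unital_EL A (s 1%g) S. Proof. exact: system_unital_EL. Qed.
Let u_l a : s 1%g ** a = a. Proof. by case: (EL_unit SE a). Qed.
Let u_r a : a ** s 1%g = a. Proof. by case: (EL_unit SE a). Qed.

(* The canonical representation on the square summable functions on the
   Markov chain, where p t acts as multiplication by the indicator of t. *)
Lemma system_cproj_faithful t : (forall i, p t ** S i = 0) -> cset A t = set0.
Proof.
move=> pt0; have ME := model_unital_EL R A.
have [_ _ /(_ _ _ (rho_system_relations A_no_zero_row ME))[f fH fs]] := U_s.
have fS i : f (S i) = model_op R A i.
  by rewrite fs /= /rho_letter /=; case: (EL_unit ME (model_op R A i)).
have f1 : f (s 1%g) = id_op R _ by rewrite fs.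
have fp t' : f (p t') = cproj (id_op R _) (model_op R A) t'.
  elim: t' => [|b|t1 h1 t2 h2|t1 h1|a t1 h1] //=.
  - by rewrite (homM fH) (hom_star fH) fS.
  - by rewrite (homM fH) h1 h2.
  - by rewrite (homB fH) h1 f1.
  - by rewrite !(homM fH) (hom_star fH) fS h1.
rewrite -subset0 => x xt; apply: (model_cproj_neq0 (R := R) xt).
by rewrite -fp -fS -(homM fH) pt0 (hom0 fH).
Qed.

(** The elements 1 - p t of J serve as an approximate unit at [a]. Including [star a] makes the
    condition stable under the involution. *)
Let small a := forall e : R[i]%C, 0 < e -> exists t,
  [/\ J (s 1%g - p t), `|p t ** a| < e & `|p t ** star a| < e].

Let p_norm t : `|p t| <= 1. Proof. exact: cnorm_projection (cprojP SE t). Qed.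

Let J_and t t' : J (s 1%g - p t) -> J (s 1%g - p t') ->
  J (s 1%g - p (CAnd t t')).
Proof.
move=> Jt Jt'; have := cproj_or sP (CNot t) (CNot t'); rewrite /= !subKr => ->.
have [[_ GD _ GM _] _] := cstar_gen_subalgebra (range S).
by apply: (subalgebraB (cstar_gen_subalgebra _)); [exact: GD|exact: GM].
Qed.

Let small_subalgebra : is_cstar_subalgebra small.
Proof.
have [[G0 GD _ GM GS] _] := cstar_gen_subalgebra (range S).
have and_le t t' a : `|p (CAnd t t') ** a| <= `|p t ** a|.
  rewrite /= (cproj_comm SE) -cmulA (le_trans (cnormM _ _)) //.
  by rewrite ler_piMl.
have and_le' t t' a : `|p (CAnd t t') ** a| <= `|p t' ** a|.
  by rewrite /= -cmulA (le_trans (cnormM _ _)) // ler_piMl.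
(* The tolerance is divided by k + 1 and not by k, since k will be the modulus of a scalar or a norm
   and may be 0. *)
have dV (k e : R[i]%C) : 0 <= k -> 0 < e -> 0 < e / (k + 1).
  by move=> k0 e0; rewrite divr_gt0 // ltr_wpDl.
have dM (k e x : R[i]%C) : 0 <= k -> 0 <= x -> x < e / (k + 1) -> x * k < e.
  move=> k0 x0; rewrite ltr_pdivlMr ?ltr_wpDl //; apply: le_lt_trans.
  by rewrite ler_wpM2l // lerDl.
split; first split.
- by move=> e e0; exists CTop; rewrite /= subrr star0 cmul0r normr0.
- move=> a b ha hb e e0; have e2 : 0 < e / 2 by rewrite divr_gt0.
  have [t [Jt ta tsa]] := ha _ e2; have [t' [Jt' tb tsb]] := hb _ e2.
  exists (CAnd t t'); rewrite starD !cmulDr [e]splitr; split; first exact: J_and.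
    rewrite (le_lt_trans (ler_normD _ _)) // ltrD //.
      exact: le_lt_trans (and_le _ _ _) ta.
    exact: le_lt_trans (and_le' _ _ _) tb.
  rewrite (le_lt_trans (ler_normD _ _)) // ltrD //.
    exact: le_lt_trans (and_le _ _ _) tsa.
  exact: le_lt_trans (and_le' _ _ _) tsb.
- move=> k a ha e e0; have [t [Jt ta tsa]] := ha _ (dV _ e (normr_ge0 k) e0).
  exists t; rewrite starZ !cmulZr !normrZ norm_conjC.
  by split=> //; rewrite mulrC dM.
- move=> a b ha hb e e0.
  have [t [Jt ta _]] := ha _ (dV _ e (normr_ge0 b) e0).
  have [t' [Jt' _ tsb]] := hb _ (dV _ e (normr_ge0 a) e0).
  exists (CAnd t t'); split; first exact: J_and.
    rewrite cmulA (le_lt_trans (cnormM _ _)) // dM //.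
    exact: le_lt_trans (and_le _ _ _) ta.
  rewrite starM cmulA (le_lt_trans (cnormM _ _)) // cnorm_star dM //.
  exact: le_lt_trans (and_le' _ _ _) tsb.
- by move=> a ha e e0; have [t [Jt ta tsa]] := ha _ e0; exists t; rewrite starK.
apply/closedP => a ha e e0; have e2 : 0 < e / 2 by rewrite divr_gt0.
have [b hb ab] := ha _ e2; have [t [Jt tb tsb]] := hb _ e2.
have pD c d : `|c - d| < e / 2 -> `|p t ** d| < e / 2 -> `|p t ** c| < e.
  move=> cd td; rewrite -(subrK d c) cmulDr [e]splitr.
  rewrite (le_lt_trans (ler_normD _ _)) // ltrD // (le_lt_trans (cnormM _ _)) //.
  by apply: le_lt_trans cd; rewrite ler_piMl.
exists t; split=> //; first exact: pD tb.
by apply: pD tsb; rewrite -starB cnorm_star.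
Qed.

Let small_gen i : small (S i).
Proof.
(* The factor 1 - S_i S_i^* annihilates S_i and the factor 1 - S_i^* S_i annihilates its adjoint;
   the two factors commute. *)
move=> e e0; exists (CAnd (CNot (CQ i)) (CNot (CCons i CTop))).
have [[_ _ _ GM GS] _] := cstar_gen_subalgebra (range S).
have GSi : J (S i) by apply: cstar_gen_incl; exists i.
have e1 : p (CNot (CCons i CTop)) ** S i = 0.
  by rewrite /= u_r cmulBl u_l (EL_isom SE) subrr.
have e2 : p (CNot (CQ i)) ** star (S i) = 0.
  rewrite /= cmulBl u_l -{1}(EL_isom SE i) !starM starK cmulA.
  by rewrite subrr.
split.
- by apply: J_and; rewrite /= subKr; [|rewrite u_r]; apply: GM => //; exact: GS.
- by rewrite [p _]/(p (CNot (CQ i)) ** p (CNot (CCons i CTop))) -cmulA e1 cmul0r normr0.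
have -> : p (CAnd (CNot (CQ i)) (CNot (CCons i CTop))) =
    p (CNot (CCons i CTop)) ** p (CNot (CQ i)).
  exact: (cproj_comm SE (CNot (CQ i)) (CNot (CCons i CTop))).
by rewrite -cmulA e2 cmul0r normr0.
Qed.

(* Elements of J are almost annihilated by projections p t with 1 - p t in J,
   so a unit e of J satisfies p t e = 0 for some t; as p t then annihilates
   every S i, t is empty by faithfulness and 1 belongs to J. *)
Lemma system_unit e : J e -> (forall a, J a -> e ** a = a /\ a ** e = a) ->
  e = s 1%g.
Proof.
move=> Je eP; have Js : J (star e).
  by have [[_ _ _ _ GS] _] := cstar_gen_subalgebra (range S); exact: GS.
have es : star e = e.
  have [h _] := eP _ Js; rewrite -[in RHS](starK e) -[in RHS]h starM starK.
  by rewrite h.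
(* The tolerance 1 suffices because a projection of norm below 1 is 0, and [p t ** e] is a
   projection: e commutes with 1 - p t, an element of J. *)
have [|t [Jt te _]] := cstar_gen_min small_subalgebra _ Je 1 ltr01.
  by move=> _ [i _ <-]; exact: small_gen.
have [pp ps] := cprojP SE t.
have te_comm : p t ** e = e ** p t.
  have [h1 h2] := eP _ Jt; move: h1 h2; rewrite cmulBl cmulBr u_l u_r => h1 h2.
  by apply: oppr_inj; apply: (addrI e); rewrite h1 h2.
have pe0 : p t ** e = 0.
  apply: small_projection_eq0 te; split.
    by rewrite {2}te_comm cmulA -(cmulA (p t)) (proj1 (eP _ Je)) -cmulA -te_comm cmulA pp.
  by rewrite starM es ps.
have t0 : cset A t = set0.
  apply: system_cproj_faithful => i.
  have [h _] : e ** S i = S i /\ S i ** e = S i.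
    by apply: eP; apply: cstar_gen_incl; exists i.
  by rewrite -h cmulA pe0 cmul0l.
move: Jt; rewrite (cproj_empty A_no_zero_row SE t0) subr0 => /eP[h _].
by rewrite -h u_r.
Qed.

End SystemUnit.

(** * The isomorphism *)

(** Reduces to generators the check that a self-adjoint element acts as a unit on a C*-algebra. *)
Lemma fixed_subalgebra (R : realType) (B : cstarType R) (e : B) : star e = e ->
  is_cstar_subalgebra [set a | e ** a = a /\ a ** e = a].
Proof.
move=> es; split; first split=> /=.
- by rewrite cmul0l cmul0r.
- by move=> a b [a1 a2] [b1 b2]; rewrite cmulDl cmulDr a1 a2 b1 b2.
- by move=> k a [a1 a2]; rewrite cmulZl cmulZr a1 a2.
- by move=> a b [a1 a2] [b1 b2]; rewrite cmulA a1 -cmulA b2.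
- by move=> a [a1 a2]; split; rewrite -{1}es -starM ?a1 ?a2.
apply/closedP => a ha /=.
have k0 : 0 <= `|e| + 1 by rewrite addr_ge0.
split; apply/subr0_eq/(norm_le_eps_eq0 k0) => d d0;
  have [b /= [b1 b2] /ltW ab] := ha d d0; rewrite mulrDl mul1r.
- have -> : e ** a - a = e ** (a - b) - (a - b).
    by rewrite cmulBr b1 opprB addrA subrK.
  rewrite (le_trans (ler_normB _ _)) // lerD // (le_trans (cnormM _ _)) //.
  by rewrite ler_wpM2l.
- have -> : a ** e - a = (a - b) ** e - (a - b).
    by rewrite cmulBl b2 opprB addrA subrK.
  rewrite (le_trans (ler_normB _ _)) // lerD // (le_trans (cnormM _ _)) //.
  by rewrite mulrC ler_wpM2l.
Qed.

(** The type of [unitization_in] depends on the decision whether B is unital; abstracting the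
    algebra and the inclusion together makes the case analysis well typed. *)
Lemma unitization_ind (R : realType) (B : cstarType R)
    (P : forall U : cstarType R, (B -> U) -> Prop) :
  (is_unital B -> P B id) ->
  (~ is_unital B -> P (adjoin_unit B) (@adj_in R B)) ->
  P (unitization B) (@unitization_in R B).
Proof.
rewrite /unitization /unitization_in.
by case: pselect => h; [move=> /(_ h)|move=> _ /(_ h)].
Qed.

Theorem theorem7p5 (R : realType) (I : choiceType) (A : I -> I -> bool)
    (A_no_zero_row : forall i, exists j, A i j)
    (C : cstarType R) (s : freegrp I -> C)
    (C_s : is_system_algebra (markov_system A) s)
    (O : cstarType R) (S : I -> O) (O_S : is_exel_laca A S) :
  cstar_gen ([set e | is_unit e] `|` range (fun i => s (fgen i))) = setT /\
  exists f : C -> unitization O,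
    [/\ is_star_iso f, is_unital_map f &
        forall i, f (s (fgen i)) = unitization_in (S i)].
Proof.
have [sP sT s_univ] := C_s.
have [[S_isom [S_u S_nu] S_comm S_orth S_shift] ST S_univ] := O_S.
have SE := system_unital_EL sP; have uC := EL_unit SE.
have gen : cstar_gen ([set e | is_unit e] `|` range (fun i => s (fgen i))) = setT.
  apply/seteqP; split=> // a _; suff : cstar_gen (range s) `<=`
    cstar_gen ([set e | is_unit e] `|` range (fun i => s (fgen i))).
    by rewrite sT; apply.
  apply: cstar_gen_min; first exact: cstar_gen_subalgebra.
  by move=> _ [g _ <-]; exact: (system_generated sP).
split=> //.
have [g gH gS] := S_univ C _ (unital_EL_relations SE (system_unit A_no_zero_row C_s)).
have ext_id (h : C -> C) : is_star_hom h -> h (s 1%g) = s 1%g ->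
    (forall i, h (s (fgen i)) = s (fgen i)) -> forall a, h a = a.
  move=> hH h1 hs; apply: (hom_ext hH (id_star_hom C) gen) => a [ua|[i _ <-]] //.
  by rewrite (is_unit_unique ua uC).
have fromEL (U : cstarType R) (u : U) (T : I -> U) : unital_EL A u T ->
    exists f : C -> U,
      [/\ is_star_hom f, f (s 1%g) = u & forall i, f (s (fgen i)) = T i].
  move=> TE; have [f fH fs] := s_univ _ _ (rho_system_relations A_no_zero_row TE).
  exists f; split=> [//||i]; first by rewrite fs.
  by rewrite fs /= /rho_letter /=; case: (EL_unit TE (T i)).
have finish (U : cstarType R) (u : U) (T : I -> U) (h : U -> C) (f : C -> U) :
    is_unit u -> is_star_hom f -> f (s 1%g) = u -> (forall i, f (s (fgen i)) = T i) ->
    is_star_hom h -> h u = s 1%g -> (forall i, h (T i) = s (fgen i)) ->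
    (forall a, f (h a) = a) ->
    exists f : C -> U, [/\ is_star_iso f, is_unital_map f &
        forall i, f (s (fgen i)) = T i].
  move=> uU fH f1 fT hH h1 hT fh; exists f; split=> //; last first.
    by move=> e /(is_unit_unique uC) <-; rewrite f1.
  split=> //; exists h => //; apply: (ext_id (fun a => h (f a))).
  - exact: comp_star_hom.
  - by rewrite f1.
  - by move=> i; rewrite fT.
apply: (unitization_ind (P := fun U iota => exists f : C -> U,
  [/\ is_star_iso f, is_unital_map f & forall i, f (s (fgen i)) = iota (S i)])).
- move=> [u uO]; have SuE : unital_EL A u S.
    by split=> //; apply: S_u; split; [rewrite ST|move=> a _; exact: uO].
  have [f [fH f1 fS]] := fromEL _ _ _ SuE.
  apply: (finish _ u S g f) => //.
    (* The image of the unit of O lies in J and acts as a unit there, as it does so on the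
       generators. *)
    apply: (system_unit A_no_zero_row C_s).
      have : cstar_gen (range S) u by rewrite ST.
      apply: (cstar_gen_min (hom_preimage_subalgebra gH (cstar_gen_subalgebra _))).
      by move=> _ [i _ <-]; apply: cstar_gen_incl; exists i; rewrite ?gS.
    have gus : star (g u) = g u by rewrite -(hom_star gH) star_unit.
    apply: (cstar_gen_min (fixed_subalgebra gus)) => _ [i _ <-] /=.
    by rewrite -gS -!(homM gH); have [-> ->] := uO (S i).
  apply: (hom_ext (comp_star_hom fH gH) (id_star_hom O) ST) => _ [i _ <-].
  by rewrite gS fS.
- move=> nu; have iH := @adj_in_hom R O.
  have SuE : unital_EL A (adj_one O) (fun i => adj_in (S i)).
    split.
    - exact: adj_one_unit.
    - by move=> i; rewrite /is_partial_isometry -(hom_star iH) -!(homM iH) S_isom.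
    - apply: S_nu => -[e [_ eu]]; apply: nu; exists e => a; apply: eu.
      by rewrite ST.
    - by move=> i j; rewrite -!(hom_star iH) -!(homM iH) S_comm.
    - by move=> i j ij; rewrite -!(hom_star iH) -!(homM iH) S_orth // (hom0 iH).
    - by move=> i j; rewrite -!(hom_star iH) -!(homM iH) S_shift (homMn iH).
  have [f [fH f1 fS]] := fromEL _ _ _ SuE.
  have hH := adj_out_hom SE gH.
  apply: (finish _ (adj_one O) (fun i => adj_in (S i)) (adj_out (s 1%g) g) f) => //.
  + exact: adj_one_unit.
  + exact: adj_out_one.
  + by move=> i; rewrite adj_out_in gS.
  case=> b k; rewrite /adj_out (homD fH) (homZ fH) f1 /=.
  have -> : f (g b) = adj_in b.
    apply: (hom_ext (comp_star_hom fH gH) iH ST) => _ [i _ <-].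
    by rewrite gS fS.
  transitivity ((b + k *: 0, 0 + k * 1) : adjoin_unit O) => //.
  by rewrite scaler0 addr0 add0r mulr1.
Qed.
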